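(* Let $R$ be a Noetherian one-dimensional local domain that is analytically irreducible and residually rational, with $\operatorname{char}(R)\ne 2$, and let $v$ be the valuation of $\overline{R}$. Let $C=(R:\overline{R})$ be the conductor of $R$, let $I$ be a nonzero ideal of $R$ and let $b\in R$ be such that $v(b)$ is odd. Let $\mathcal{R}=R[It]/\big((t^2-b)\cap R[It]\big)$. Then $\mathcal{R}$ is an Arf ring if and only if all of the following hold: (i) $R$ is an Arf ring, with multiplicity sequence written as $(e_0,e_1,\ldots,e_{n-1},1,1,\ldots)$, where $e_{n-1}\ne 1$; (ii) $I$ is integrally closed; (iii) if $C\subsetneq I$, then $v(b)=e_0=e_1=\cdots=e_{n-1}$.
   Context: For a domain $A$, $Q(A)$ is its field of fractions and $\overline{A}$ its integral closure in $Q(A)$. A Noetherian one-dimensional local domain $(A,\mathfrak{n})$ is analytically irreducible if its completion is a domain, equivalently if $\overline{A}$ is a discrete valuation ring (DVR) and a finitely generated $A$-module; it is then residually rational if the natural map from $A/\mathfrak{n}$ to the residue field of $\overline{A}$ is an isomorphism. Let $w$ denote the normalized valuation of $\overline{A}$ (value group $\mathbb{Z}$); for a subset $X\subseteq Q(A)$, $w(X)$ is the set of values of nonzero elements of $X$. An ideal $H\ne 0$ of $A$ is integrally closed if it equals its integral closure in $A$; in this setting the integral closure is $\overline{H}=H\overline{A}\cap A=\{x\in A:w(x)\ge\min w(H)\}$ (with $w(0)=\infty$). $H$ is stable if $H^2=xH$, where $x\in H$ has $w(x)=\min w(H)$. $A$ is an Arf ring if every integrally closed ideal of $A$ is stable.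 The conductor is $(A:\overline{A})=\{x\in\overline{A}:x\overline{A}\subseteq A\}$. The multiplicity of $A$ is $\mu(A)=\min(w(A)\setminus\{0\})$. The blow-up of $A$ is $L(A)=\bigcup_{k\in\mathbb{N}}(\mathfrak{n}^k:\mathfrak{n}^k)$, where $(E:F)=\{x\in\overline{A}:xF\subseteq E\}$. With $A_0=A$, $A_{i+1}=L(A_i)$, the multiplicity sequence of $A$ is $(\mu(A_0),\mu(A_1),\ldots)$. It is eventually $1$, and in (i) $n\in\mathbb{N}$ is the smallest integer with $e_k=1$ for all $k\ge n$; if $n=0$ the condition $e_{n-1}\neq1$ is void. The Rees algebra is $R[It]=\bigoplus_{n\in\mathbb{N}}I^nt^n\subseteq R[t]$, $t$ an indeterminate, and $(t^2-b)$ is the ideal generated by $t^2-b$ in $R[t]$. Under these hypotheses $\mathcal{R}$ is again a Noetherian one-dimensional local domain, analytically irreducible and residually rational, so the definitions of integrally closed ideal, stable ideal and Arf ring given for $A$ apply with $A=\mathcal{R}$. *)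

(* Defs.v *)
From HB Require Import structures.
From mathcomp Require Import all_boot all_order all_algebra.
From mathcomp Require Import boolp classical_sets.
From mathcomp Require Import ring zify.

Set Implicit Arguments.
Unset Strict Implicit.
Unset Printing Implicit Defensive.

Import Order.TTheory GRing.Theory Num.Theory.
Local Open Scope classical_set_scope.
Local Open Scope ring_scope.

Section Ideals.
Variable A : comNzRingType.
Implicit Types (B E F H M P : set A).

Definition is_ideal H :=
  [/\ H 0, forall x y, H x -> H y -> H (x + y) & forall a x, H x -> H (a * x)].

(* finite sums of products x * y with x in E and y in F *)
Definition setM E F : set A :=
  [set z | exists2 s : seq (A * A),
     forall p, p \in s -> E p.1 /\ F p.2 & z = \sum_(p <- s) p.1 * p.2].

(* E ^ k, where E is an ideal of the subring B; E ^ 0 = B *)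
Definition setX B E k : set A := iter k (setM E) B.

Definition idealX H k : set A := setX setT H k.

(* M is a finitely generated module over the subring B *)
Definition fin_gen B M :=
  exists s : seq A,
    M = [set x | exists2 c : nat -> A, forall i, B (c i) &
                 x = \sum_(i < size s) c i * s`_i].

Definition noetherian := forall H, is_ideal H -> fin_gen setT H.

Definition prime_ideal P :=
  [/\ is_ideal P, ~ P 1 & forall x y, P (x * y) -> P x \/ P y].

Definition maximal_ideal M :=
  [/\ is_ideal M, ~ M 1 & forall H, is_ideal H -> M `<` H -> H = setT].

Definition local_ring := exists! M, maximal_ideal M.

Definition has_prime_chain d :=
  exists P : nat -> set A,
    (forall i, (i <= d)%N -> prime_ideal (P i)) /\
    (forall i, (i < d)%N -> P i `<` P i.+1).

Definition krull_dim d := has_prime_chain d /\ ~ has_prime_chain d.+1.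

(* x is in the integral closure of the ideal H when
   x ^ n + a_1 x ^ (n - 1) + ... + a_n = 0 with a_i in H ^ i *)
Definition ideal_closure H : set A :=
  [set x | exists (n : nat) (a : nat -> A),
     [/\ (0 < n)%N,
         forall i, (1 <= i <= n)%N -> idealX H i (a i) &
         x ^+ n + \sum_(1 <= i < n.+1) a i * x ^+ (n - i) = 0]].

Definition integrally_closed H := ideal_closure H = H.

End Ideals.

(* Domains are represented here as subrings B of a field K with Q(B) = K *)
Section Subrings.
Variable K : fieldType.
Implicit Types (B E F V : set K) (w : K -> int).

Definition int_closure B : set K :=
  [set z | exists p : {poly K}, [/\ p \is monic, forall i, B p`_i & root p z]].

Definition nonunits B : set K :=
  [set x | B x /\ ~ (exists2 y, B y & x * y = 1)].

(* The value of w at 0 is irrelevant: w(0) stands for infinity, so all uses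
   of w are restricted to nonzero elements. *)
Definition normalized_valuation V w :=
  [/\ forall x y, x != 0 -> y != 0 -> w (x * y) = w x + w y,
      forall x y, x != 0 -> y != 0 -> x + y != 0 ->
        Num.min (w x) (w y) <= w (x + y),
      forall m : int, exists2 x, x != 0 & w x = m &
      V = [set x | x = 0 \/ 0 <= w x]].

Definition is_DVR V := exists w, normalized_valuation V w.

(* the normalized valuation of the integral closure of B; it is unique, and
   exists as soon as this integral closure is a DVR *)
Definition valuation B : K -> int :=
  xget (fun=> 0) [set w | normalized_valuation (int_closure B) w].

Definition values w (X : set K) : set int :=
  [set m | exists x, [/\ X x, x != 0 & w x = m]].

(* (E : F), inside the integral closure of B *)
Definition colon B E F : set K :=
  [set x | int_closure B x /\ forall y, F y -> E (x * y)].

Definition is_min (S : set int) m := S m /\ forall k, S k -> m <= k.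

Definition multiplicity B : int :=
  xget 0 [set m | is_min (values (valuation B) B `\ 0) m].

(* nonunits B is the maximal ideal of B when B is local *)
Definition blowup B : set K :=
  \bigcup_(k in [set: nat])
    colon B (setX B (nonunits B) k) (setX B (nonunits B) k).

Definition mult_seq B (i : nat) : int := multiplicity (iter i blowup B).

End Subrings.

Section Domains.
Variable A : idomainType.

(* A as a subring of its field of fractions *)
Definition frac_range : set {fraction A} := range (@tofrac A).

(* For a Noetherian one-dimensional local domain this is equivalent to its
   completion being a domain. *)
Definition analytically_irreducible :=
  is_DVR (int_closure frac_range) /\ fin_gen frac_range (int_closure frac_range).

(* With n and m the maximal ideals of A and of its integral closure Abar,
   the two clauses say that A / n -> Abar / m is well defined and
   injective, resp. surjective *)
Definition residually_rational :=
  (forall a, frac_range a ->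
     nonunits frac_range a <-> nonunits (int_closure frac_range) a) /\
  (forall z, int_closure frac_range z ->
     exists2 a, frac_range a & nonunits (int_closure frac_range) (z - a)).

Definition value (x : A) : int := valuation frac_range (tofrac x).

Definition stable (H : set A) :=
  exists x, [/\ H x, x != 0, forall y, H y -> y != 0 -> value x <= value y &
                setM H H = [set x * y | y in H]].

Definition Arf :=
  forall H : set A, is_ideal H -> H != [set 0] -> integrally_closed H ->
    stable H.

Definition conductor : set {fraction A} :=
  colon frac_range frac_range (int_closure frac_range).

(* value b is odd; in particular it is finite, that is, b is nonzero *)
Definition odd_val (b : A) := b != 0 /\ odd `|value b|%N.

Definition frac_nonsquare (b : A) := ~ exists z : {fraction A}, z ^+ 2 = tofrac b.

Lemma odd_val_nonsquare (b : A) :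
  analytically_irreducible -> odd_val b -> frac_nonsquare b.
Proof.
move=> [[w0 hw0] _] [b0 ob] [z zb].
have [wM _ _ _] : normalized_valuation (int_closure frac_range)
    (valuation frac_range) by apply: (xgetPex (fun=> 0)); exists w0.
have z0 : z != 0.
  by apply: contra_neq b0 => z0; apply/eqP; rewrite -tofrac_eq0 -zb z0 expr0n.
by move: ob; rewrite /value -zb expr2 wM //; lia.
Qed.

End Domains.

Arguments frac_range A : clear implicits.
Arguments conductor A : clear implicits.

(* R[It] as a subring of R[t] *)
Section Rees.
Variables (R : idomainType) (I : set R).

Definition rees_pred : {pred {poly R}} :=
  fun p => `[< forall i, idealX I i p`_i >].

Lemma setM_add (E F : set R) x y :
  setM E F x -> setM E F y -> setM E F (x + y).
Proof.
move=> [s hs ->] [t ht ->]; exists (s ++ t); last by rewrite big_cat.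
by move=> p; rewrite mem_cat => /orP[/hs|/ht].
Qed.

Lemma idealX_ideal k : is_ideal (idealX I k).
Proof.
elim: k => [//|k [h0 hD hM]]; split.
- by exists [::] => //; rewrite big_nil.
- by move=> x y; apply: setM_add.
- move=> a _ [s hs ->]; exists [seq (p.1, a * p.2) | p <- s].
    by move=> q /mapP[p /hs[p1 p2] ->] /=; split=> //; apply: hM.
  rewrite big_map mulr_sumr; apply: eq_bigr => p _ /=.
  by rewrite mulrCA.
Qed.

Lemma idealX_sum k (T : Type) (s : seq T) (P : pred T) (f : T -> R) :
  (forall i, P i -> idealX I k (f i)) -> idealX I k (\sum_(i <- s | P i) f i).
Proof.
have [h0 hD _] := idealX_ideal k.
by move=> hf; apply: big_ind.
Qed.

Lemma idealXD i j x y : idealX I i x -> idealX I j y -> idealX I (i + j) (x * y).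
Proof.
elim: i x => [|i IH] x hx hy.
  by have [_ _ hM] := idealX_ideal j; apply: hM.
case: hx => s hs ->; exists [seq (p.1, p.2 * y) | p <- s].
  by move=> q /mapP[p /hs[p1 p2] ->] /=; split=> //; apply: IH.
by rewrite big_map mulr_suml; apply: eq_bigr => p _; rewrite mulrA.
Qed.

Lemma rees_subring : subring_closed rees_pred.
Proof.
split.
- apply/asboolP => i; rewrite coef1; case: i => [//|i] /=.
  by case: (idealX_ideal i.+1).
- move=> p q /asboolP hp /asboolP hq; apply/asboolP => i.
  have [_ hD hM] := idealX_ideal i.
  by rewrite coefB -mulN1r; apply: hD => //; apply: hM.
- move=> p q /asboolP hp /asboolP hq; apply/asboolP => i.
  rewrite coefM; apply: idealX_sum => j _.
  rewrite -[X in idealX I X](subnKC (leq_ord j)); exact: idealXD.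
Qed.

HB.instance Definition _ :=
  GRing.isSubringClosed.Build {poly R} rees_pred rees_subring.

Record rees := Rees { rees_poly : {poly R}; _ : rees_poly \in rees_pred }.

HB.instance Definition _ := [isSub for rees_poly].
HB.instance Definition _ := [Choice of rees by <:].
HB.instance Definition _ := [SubChoice_isSubComNzRing of rees by <:].

Variable b : R.

(* (t ^ 2 - b) R[t] intersected with R[It] *)
Definition quad_ideal : {pred rees} :=
  fun p => `[< exists q : {poly R}, rees_poly p = q * ('X^2 - b%:P) >].

Lemma quad_ideal_closed : idealr_closed quad_ideal.
Proof.
split.
- by apply/asboolP; exists 0; rewrite mul0r.
- apply/negP => /asboolP[q /= h].
  have mq : 'X^2 - b%:P \is monic by apply: monicXnsubC.
  have [q0|q0] := eqVneq q 0.
    by move/eqP: h; rewrite q0 mul0r oner_eq0.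
  have := congr1 (fun p : {poly R} => size p) h.
  rewrite size_Mmonic // size_XnsubC // size_poly1.
  by have := size_poly_gt0 q; rewrite q0; lia.
- move=> a p q /asboolP[u hu] /asboolP[v hv]; apply/asboolP.
  exists (rees_poly a * u + v).
  by rewrite mulrDl -mulrA -hu -hv.
Qed.

HB.instance Definition _ := isIdealr.Build rees quad_ideal quad_ideal_closed.

(* If b is not a square in Q(R), then t ^ 2 - b is irreducible over Q(R),
   which makes the quotient below a domain. *)
Lemma quad_prime : frac_nonsquare b ->
  forall p q : {poly R}, (exists u, p * q = u * ('X^2 - b%:P)) ->
  (exists u, p = u * ('X^2 - b%:P)) \/ (exists u, q = u * ('X^2 - b%:P)).
Proof.
move=> hb; set m := 'X^2 - b%:P.
have mm : m \is monic by apply: monicXnsubC.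
have sm : size m = 3%N by rewrite size_XnsubC.
have hsq (x c : R) : x ^+ 2 = b * c ^+ 2 -> x = 0 /\ c = 0.
  move=> h; have c0 : c = 0.
    apply/eqP/negPn/negP => c0; apply: hb; exists (tofrac x / tofrac c).
    have cf : tofrac c != 0 by rewrite tofrac_eq0.
    by rewrite expr_div_n -!tofracXn h tofracM tofracXn mulfK // expf_neq0.
  split=> //; apply/eqP; move/eqP: h.
  by rewrite c0 expr0n mulr0 sqrf_eq0.
have dec (p : {poly R}) : exists u (a c : R), p = u * m + (a%:P + c *: 'X).
  exists (Pdiv.Ring.rdivp p m), (Pdiv.Ring.rmodp p m)`_0, (Pdiv.Ring.rmodp p m)`_1.
  rewrite {1}(Pdiv.RingMonic.rdivp_eq mm p); congr (_ + _).
  have := Pdiv.Ring.ltn_rmodpN0 p (monic_neq0 mm); rewrite sm.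
  move: (Pdiv.Ring.rmodp p m) => r sr; apply/polyP => i.
  rewrite coefD coefC coefZ coefX.
  case: i => [|[|i]] /=; rewrite ?mulr0 ?mulr1 ?addr0 ?add0r //.
  by rewrite nth_default //; apply: (@leq_trans 2).
move=> p q [w hw].
have [u [a [c hp]]] := dec p; have [u' [a' [c' hq]]] := dec q.
pose A0 := a * a' + b * (c * c'); pose A1 := a * c' + c * a'.
have E : A0%:P + A1 *: 'X =
   (w - (u * q + (a%:P + c *: 'X) * u' + (c * c')%:P)) * m.
  rewrite !mulrBl -hw hp hq /A0 /A1 /m -!mul_polyC !(polyCD, polyCM).
  ring.
have E0 : A0%:P + A1 *: 'X = 0.
  apply/eqP/negPn/negP => n0; move: E n0; set r := (w - _) => E.
  have [r0|r0] := eqVneq r 0; first by rewrite E r0 mul0r eqxx.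
  move=> _; have := congr1 (fun p : {poly R} => size p) E.
  rewrite size_Mmonic // sm.
  have : (size (A0%:P + A1 *: 'X)%R <= 2)%N.
    apply: (leq_trans (size_polyD _ _)); rewrite geq_max.
    apply/andP; split; first by apply: leq_trans (size_polyC_leq1 _) _.
    by apply: leq_trans (size_scale_leq _ _) _; rewrite size_polyX.
  move=> sE hE; rewrite hE in sE; move: sE.
  by have := size_poly_gt0 r; rewrite r0; case: (size r) => // k _; rewrite addnS; lia.
have h0 : A0 = 0.
  move/polyP/(_ 0%N): E0.
  by rewrite coefD coefC coefZ coefX /= mulr0 addr0 coef0.
have h1 : A1 = 0.
  move/polyP/(_ 1%N): E0.
  by rewrite coefD coefC coefZ coefX /= mulr1 add0r coef0.
have N : (a ^+ 2 - b * c ^+ 2) * (a' ^+ 2 - b * c' ^+ 2) = 0.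
  have -> : (a ^+ 2 - b * c ^+ 2) * (a' ^+ 2 - b * c' ^+ 2)
            = A0 ^+ 2 - b * A1 ^+ 2 by rewrite /A0 /A1; ring.
  by rewrite h0 h1 !expr0n mulr0 subr0.
move/eqP: N; rewrite mulf_eq0 !subr_eq0 => /orP[]/eqP/hsq[e1 e2].
  by left; exists u; rewrite hp e1 e2 scale0r !addr0.
by right; exists u'; rewrite hq e1 e2 scale0r !addr0.
Qed.

(* R[It] / ((t ^ 2 - b) R[t] meet R[It]); the hypothesis on b only serves to give the
   quotient its structure of domain *)
Definition rees_quot of frac_nonsquare b := {ideal_quot quad_ideal}.

Section Quotient.
Variable hb : frac_nonsquare b.
Local Notation Q := (rees_quot hb).

HB.instance Definition _ := GRing.ComNzRing.on Q.

Lemma rees_quot_idomain (x y : Q) : x * y = 0 -> (x == 0) || (y == 0).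
Proof.
have piE0 (p : rees) :
    ((\pi p)%qT == 0 :> {ideal_quot quad_ideal}) = (p \in quad_ideal).
  by rewrite !piE Quotient.equivE subr0.
move=> /eqP; rewrite -[x]reprK -[y]reprK.
move: (repr x) (repr y) => p q.
rewrite -(rmorphM (\pi_({ideal_quot quad_ideal}))%qT) !piE0 => /asboolP h.
by apply/orP; case: (quad_prime hb h) => h'; [left|right]; apply/asboolP.
Qed.

Definition rees_quot_unit : {pred Q} := fun x => `[< exists y, y * x = 1 >].

Definition rees_quot_inv (x : Q) : Q :=
  if x \in rees_quot_unit then xget 0 [set y | y * x = 1] else x.

Lemma rees_quot_mulV : {in rees_quot_unit, left_inverse 1 rees_quot_inv *%R}.
Proof.
move=> x ux; rewrite /rees_quot_inv ux.
by move/asboolP: ux; apply: (xgetPex 0).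
Qed.

Lemma rees_quot_unitP (x y : Q) : y * x = 1 -> x \in rees_quot_unit.
Proof. by move=> h; apply/asboolP; exists y. Qed.

Lemma rees_quot_inv_out :
  {in [predC rees_quot_unit], rees_quot_inv =1 id}.
Proof. by move=> x /negbTE ux; rewrite /rees_quot_inv ux. Qed.

HB.instance Definition _ := GRing.ComNzRing_hasMulInverse.Build Q
  rees_quot_mulV rees_quot_unitP rees_quot_inv_out.
HB.instance Definition _ :=
  GRing.ComUnitRing_isIntegral.Build Q rees_quot_idomain.

End Quotient.
End Rees.

(* Main.v *)
Require Import Defs.
From HB Require Import structures.
From mathcomp Require Import all_boot all_order all_algebra.
From mathcomp Require Import boolp classical_sets.
From mathcomp Require Import ring zify.

(* An analytically irreducible local domain [A] with valuation [w] is Arf iff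
   [y z / x] lies in [A] whenever [x, y, z] do and [w x <= w y, w z].  Over
   [K = Q(R)] the ring of the theorem is [S = R + I th] with [th ^ 2 = b]; as
   [v b] is odd, its valuation is [w (x + y th) = min (2 v x) (2 v y + v b)].

   If [S] is Arf, so is [R], and [I] is integrally closed.  When [I] exceeds the
   conductor, it contains some [d] with [v d = s_(n-1)], where
   [s_k = e_0 + ... + e_(k-1)] enumerates the values of [R].  The condition on
   [S] puts [y ^ 2 / (d b)] in [I], which falls in a gap of [v(R)] for a suitable
   [y] unless [v b <= e_(n-1)]; but [b] in [R] gives [e_0 <= v b], and [e] is
   nonincreasing.

   Conversely it is enough to test the condition on [S] at one [x] of each value,
   that is at [x] in [R] and at [x th] with [x] in [I].  The coordinates of
   [y z / x] are then sums of terms which either have values beyond the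
   conductor, or are handled by the same condition on [R], because a value of
   [R] exceeding some [v i < s_n] with [i] in [I] is at least [v i + v b]. *)

Set Implicit Arguments.
Unset Strict Implicit.
Unset Printing Implicit Defensive.

Import Order.TTheory GRing.Theory Num.Theory.
Local Open Scope classical_set_scope.
Local Open Scope ring_scope.

(** * Normalized valuations, subrings of a field, and the Arf condition at one element *)

Section Valuation.
Variable F : fieldType.
Implicit Types (x y z : F) (v w : F -> int) (m n : int) (A B H V : set F).

(** [v 0] is an arbitrary integer, so the convention that 0 has infinite value is built into the
    comparison. *)
Definition vge v m x := x = 0 \/ m <= v x.

Section Fixed.
Variables (V : set F) (v : F -> int).
Hypothesis hv : normalized_valuation V v.

Lemma val_mul x y : x != 0 -> y != 0 -> v (x * y) = v x + v y.
Proof. by case: hv => h _ _ _; apply: h. Qed.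

Lemma val_one : v 1 = 0.
Proof.
have : v (1 * 1) = v 1 + v 1 by apply: val_mul; exact: oner_neq0.
by rewrite mulr1; lia.
Qed.

Lemma val_inv x : x != 0 -> v x^-1 = - v x.
Proof.
move=> x0; have := val_mul x0 (invr_neq0 x0).
by rewrite divff // val_one; lia.
Qed.

Lemma val_div x y : x != 0 -> y != 0 -> v (x / y) = v x - v y.
Proof. by move=> x0 y0; rewrite val_mul ?invr_neq0 // val_inv. Qed.

Lemma val_opp x : x != 0 -> v (- x) = v x.
Proof.
move=> x0; have n1 : (-1 : F) != 0 by rewrite oppr_eq0 oner_neq0.
have : v (-1 * -1) = v (-1) + v (-1) by apply: val_mul.
have -> : - x = -1 * x by rewrite mulN1r.
by rewrite mulrNN mulr1 val_one (val_mul n1) //; lia.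
Qed.

Lemma val_exp x k : x != 0 -> v (x ^+ k) = v x * k%:Z.
Proof.
move=> x0; elim: k => [|k IH]; first by rewrite expr0 val_one mulr0.
by rewrite exprS val_mul ?expf_neq0 // IH; lia.
Qed.

Lemma val_exists m : exists2 x, x != 0 & v x = m.
Proof. by case: hv. Qed.

Lemma val_ring x : V x <-> vge v 0 x.
Proof. by case: hv => _ _ _ ->. Qed.

Lemma vge_le m n x : m <= n -> vge v n x -> vge v m x.
Proof. by move=> mn [->|h]; [left|right; apply: le_trans h]. Qed.

Lemma vgeN0 m x : x != 0 -> vge v m x -> m <= v x.
Proof. by move=> /eqP x0 []. Qed.

Lemma vgeD m x y : vge v m x -> vge v m y -> vge v m (x + y).
Proof.
move=> [->|hx]; first by rewrite add0r.
move=> [->|hy]; first by rewrite addr0; right.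
have [->|x0] := eqVneq x 0; first by rewrite add0r; right.
have [->|y0] := eqVneq y 0; first by rewrite addr0; right.
have [->|s0] := eqVneq (x + y) 0; first by left.
right; case: hv => _ h _ _; have := h _ _ x0 y0 s0.
by apply: le_trans; rewrite le_min hx.
Qed.

Lemma vgeN m x : vge v m x -> vge v m (- x).
Proof.
move=> [->|h]; first by rewrite oppr0; left.
have [->|x0] := eqVneq x 0; first by rewrite oppr0; left.
by right; rewrite val_opp.
Qed.

Lemma vgeB m x y : vge v m x -> vge v m y -> vge v m (x - y).
Proof. by move=> hx /vgeN; apply: vgeD. Qed.

Lemma vgeM m n x y : vge v m x -> vge v n y -> vge v (m + n) (x * y).
Proof.
move=> [->|hx]; first by rewrite mul0r; left.
move=> [->|hy]; first by rewrite mulr0; left.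
have [->|x0] := eqVneq x 0; first by rewrite mul0r; left.
have [->|y0] := eqVneq y 0; first by rewrite mulr0; left.
by right; rewrite val_mul //; lia.
Qed.

Lemma vge_sum m (T : Type) (s : seq T) (P : pred T) (f : T -> F) :
  (forall i, P i -> vge v m (f i)) -> vge v m (\sum_(i <- s | P i) f i).
Proof. by move=> h; apply: big_ind => //; [left | exact: vgeD]. Qed.

Lemma vge_self x : vge v (v x) x. Proof. by right. Qed.

Lemma vgeV x : x != 0 -> vge v (- v x) x^-1.
Proof. by move=> x0; right; rewrite val_inv. Qed.

Lemma vge_div m x y : y != 0 -> vge v m x -> vge v (m - v y) (x / y).
Proof. by move=> y0 hx; apply: vgeM => //; exact: vgeV. Qed.

Lemma val_ring1 : V 1.
Proof. by apply/val_ring; right; rewrite val_one. Qed.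

(* If [v x < 0], the leading term of a monic equation for [x] has strictly
   smaller value than all the others. *)
Lemma int_closure_sub B : B `<=` V -> int_closure B `<=` V.
Proof.
move=> BV z [p [mp cp rp]]; apply/val_ring.
have [->|z0] := eqVneq z 0; first by left.
right; rewrite leNgt; apply/negP => zn.
move: rp; rewrite /root horner_coef.
have sp : (0 < size p)%N by rewrite size_poly_gt0 monic_neq0.
rewrite -(prednK sp) big_ord_recr /= -lead_coefE (eqP mp) mul1r.
rewrite addrC addr_eq0 => /eqP hz.
have : vge v (v z * (size p).-1%:Z - v z) (z ^+ (size p).-1).
  rewrite hz; apply: vgeN; apply: vge_sum => i _.
  apply: (@vge_le _ (0 + v z * i%:Z)).
    have aux (k : int) (N j : nat) : k < 0 -> (j < N)%N -> k * N%:Z - k <= 0 + k * j%:Z.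
      by move=> k0 jN; have : 0 <= - k * (N%:Z - 1 - j%:Z); [apply: mulr_ge0|]; lia.
    exact: aux.
  by apply: vgeM; [exact/val_ring/BV | right; rewrite val_exp].
by move=> /(vgeN0 (expf_neq0 _ z0)); rewrite val_exp //; lia.
Qed.

Lemma min_value (P : set F) x0 : (forall x, P x -> vge v 0 x) -> P x0 ->
  x0 != 0 -> exists x, [/\ P x, x != 0 & forall y, P y -> vge v (v x) y].
Proof.
move=> P0 Px0 x00.
pose Q (k : nat) := `[< exists x, [/\ P x, x != 0 & v x = k%:Z] >].
have vP x : P x -> x != 0 -> v x = `|v x|%N.
  by move=> /P0 h /vgeN0 /(_ h) ?; rewrite gez0_abs.
have exQ : exists k, Q k.
  by exists `|v x0|%N; apply/asboolP; exists x0; split=> //; apply: vP.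
case: (ex_minnP exQ) => k /asboolP[x [Px xn0 vx]] kmin.
exists x; split=> // y Py; have [->|yn0] := eqVneq y 0; first by left.
right; rewrite vx vP // lez_nat; apply: kmin; apply/asboolP.
by exists y; split=> //; apply: vP.
Qed.

End Fixed.

(** The ring [V] determines the sign of both valuations, so [w] vanishes where [v] does. Dividing
    [x] by a power of some [t] with [v t = 1] gives [w x = v x * w t]; as [w] takes the value 1 and
    [w t >= 0], the factor [w t] is 1. *)
Lemma normalized_valuation_uniq V v w : normalized_valuation V v ->
  normalized_valuation V w -> forall x, x != 0 -> v x = w x.
Proof.
move=> hv hw.
have sgn x : x != 0 -> (0 <= v x) = (0 <= w x).
  move=> x0; apply/idP/idP => h.
    by apply: (vgeN0 x0); apply/(val_ring hw)/(val_ring hv); right.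
  by apply: (vgeN0 x0); apply/(val_ring hv)/(val_ring hw); right.
have zero x : x != 0 -> v x = 0 -> w x = 0.
  move=> x0 vx; have := sgn x x0; have := sgn _ (invr_neq0 x0).
  by rewrite (val_inv hv) // (val_inv hw) // vx; lia.
have [t t0 vt] := val_exists hv 1.
have lin x : x != 0 -> w x = v x * w t.
  move=> x0; have tn k : t ^+ k != 0 by rewrite expf_neq0.
  have [vx|vx] := leP 0 (v x).
    have := @zero (x / t ^+ `|v x|%N).
    rewrite mulf_neq0 ?invr_neq0 // (val_div hv) // (val_div hw) // (val_exp hv) //.
    rewrite (val_exp hw) // vt gez0_abs // mul1r subrr => /(_ isT erefl) /eqP.
    by rewrite subr_eq0 mulrC => /eqP.
  have := @zero (x * t ^+ `|v x|%N).
  rewrite mulf_neq0 // (val_mul hv) // (val_mul hw) // (val_exp hv) //.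
  rewrite (val_exp hw) // vt ltz0_abs // mul1r subrr => /(_ isT erefl) /eqP.
  by rewrite mulrN subr_eq0 mulrC => /eqP.
have [u u0 wu] := val_exists hw 1.
have wt : 0 <= w t by rewrite -sgn // vt.
have wt1 : w t = 1.
  have := lin u u0; rewrite wu; move: (v u) (w t) wt => k l l0 kl.
  have : `|l|%N == 1%N.
    have := congr1 absz kl; rewrite abszM => /esym/eqP.
    by rewrite muln_eq1 => /andP[].
  by lia.
by move=> x x0; rewrite lin // wt1 mulr1.
Qed.

Definition subring_set A :=
  [/\ A 1, forall x y, A x -> A y -> A (x - y) &
      forall x y, A x -> A y -> A (x * y)].

Section SubringSet.
Variable A : set F.
Hypothesis hA : subring_set A.

Lemma subring1 : A 1. Proof. by case: hA. Qed.

Lemma subringB x y : A x -> A y -> A (x - y).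
Proof. by case: hA => _ h _; apply: h. Qed.

Lemma subringM x y : A x -> A y -> A (x * y).
Proof. by case: hA => _ _; apply. Qed.

Lemma subring0 : A 0.
Proof. by have := subringB subring1 subring1; rewrite subrr. Qed.

Lemma subringN x : A x -> A (- x).
Proof. by move=> h; rewrite -sub0r; apply: subringB => //; apply: subring0. Qed.

Lemma subringD x y : A x -> A y -> A (x + y).
Proof. by move=> hx /subringN hy; rewrite -[y]opprK; apply: subringB. Qed.

Lemma subringX x k : A x -> A (x ^+ k).
Proof.
move=> h; elim: k => [|k IH]; first exact: subring1.
by rewrite exprS; apply: subringM.
Qed.

Lemma subring_sum (T : eqType) (s : seq T) (f : T -> F) :
  (forall i, i \in s -> A (f i)) -> A (\sum_(i <- s) f i).
Proof.
by move=> h; rewrite big_seq; apply: big_ind => //; [exact: subring0|exact: subringD].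
Qed.

Lemma sub_int_closure : A `<=` int_closure A.
Proof.
move=> x hx; exists ('X - x%:P); split; first exact: monicXsubC.
  move=> i; rewrite coefB coefX coefC.
  case: i => [|[|i]] /=; rewrite ?sub0r ?oppr0 ?addr0.
  - exact: subringN.
  - exact: subring1.
  - exact: subring0.
by rewrite root_XsubC.
Qed.

End SubringSet.

(* Lipman's criterion: the ring [A] is Arf when this holds at all [x]. *)
Definition arf_at v A x := forall y z, A y -> A z ->
  vge v (v x) y -> vge v (v x) z -> A (y * z / x).

Definition arf_set v A := forall x, A x -> x != 0 -> arf_at v A x.

(** The counterpart of [value_closed] for an ideal viewed inside the field; it expresses that [H] is
    integrally closed. *)
Definition value_ideal v A H :=
  forall i a, H i -> i != 0 -> A a -> vge v (v i) a -> H a.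

(* With [x] and [x'] of the same value, [x / x'] is a unit of the integral
   closure lying in the ring [B] of all [s / x'], [s] in [A] of value at least
   that of [x']; the inverse is integral over [B], hence in [B]. *)
Lemma arf_at_eq V v A x x' : normalized_valuation V v -> subring_set A ->
  A `<=` V -> V = int_closure A -> A x -> A x' -> x != 0 -> x' != 0 ->
  v x = v x' -> arf_at v A x' -> arf_at v A x.
Proof.
move=> hv hA AV hV Ax Ax' x0 x'0 vx ax'.
pose B : set F := [set z | vge v 0 z /\ A (x' * z)].
have hB : subring_set B.
  split.
  - by split; [apply/(val_ring hv); exact: val_ring1 hv | rewrite mulr1].
  - move=> y z [vy Ay] [vz Az]; split; first exact: (vgeB hv).
    by rewrite mulrBr; apply: subringB.
  - move=> y z [vy Ay] [vz Az]; split; first by have := vgeM hv vy vz.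
    have -> : x' * (y * z) = (x' * y) * (x' * z) / x' by field.
    have h u : vge v 0 u -> vge v (v x') (x' * u).
      by move=> /(vgeM hv (vge_self v x')); rewrite addr0.
    by apply: ax' => //; apply: h.
have AB : A `<=` B.
  by move=> a Aa; split; [exact/(val_ring hv)/AV | apply: subringM].
pose u := x / x'.
have u0 : u != 0 by rewrite mulf_neq0 ?invr_neq0.
have Bu : B u.
  split; first by right; rewrite (val_div hv) // vx subrr.
  by rewrite /u mulrCA divff // mulr1.
have Bu' : B u^-1.
  have : V u^-1 by apply/(val_ring hv); right; rewrite (val_inv hv) // (val_div hv) // vx subrr.
  rewrite hV => -[p [mp cp rp]].
  have sp : (0 < size p)%N by rewrite size_poly_gt0 monic_neq0.
  have sp2 : (1 < size p)%N.
    rewrite ltnNge; apply/negP => /size1_polyC hp.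
    move: rp mp; rewrite hp /root hornerC monicE lead_coefC => /eqP ->.
    by rewrite eq_sym oner_eq0.
  move: rp; rewrite /root horner_coef -(prednK sp) big_ord_recr /=.
  rewrite -lead_coefE (eqP mp) mul1r addrC addr_eq0 => /eqP hp.
  (* Multiplying the monic equation of [u^-1] by [u ^+ (size p).-2] isolates [u^-1] against a
     polynomial in [u]. *)
  have -> : u^-1 = - \sum_(i < (size p).-1) p`_i * u ^+ ((size p).-2 - i).
    have un : u ^+ (size p).-2 != 0 by rewrite expf_neq0.
    apply: (mulIf un).
    have e1 : (size p).-1 = (size p).-2.+1 by case: (size p) sp2 => [|[]].
    have -> : u^-1 * u ^+ (size p).-2 =
      u^-1 ^+ (size p).-1 * u ^+ (size p).-2 ^+ 2.
      rewrite e1 exprS exprVn; move: (u ^+ _) un => a a0;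
      by field; rewrite a0 u0.
    rewrite hp expr2 mulrA; congr (_ * _).
    rewrite mulNr mulr_suml; congr (- _); apply: eq_bigr => i _.
    rewrite -mulrA; congr (_ * _).
    have hi : (i <= (size p).-2)%N by have := ltn_ord i; rewrite {2}e1 ltnS.
    rewrite -{1}(subnK hi) exprD mulrCA -exprMn mulVf ?expr1n ?mulr1 //.
  apply: subringN => //; apply: subring_sum => // i _.
  by apply: subringM => //; [exact/AB/cp | exact: subringX].
move=> y z Ay Az; rewrite vx => vy vz.
have Bd y' : A y' -> vge v (v x') y' -> B (y' / x').
  move=> Ay' vy'; split; last by rewrite mulrCA divff // mulr1.
  by have := vge_div hv x'0 vy'; rewrite subrr.
have [_] := subringM hB (subringM hB (Bd y Ay vy) (Bd z Az vz)) Bu'.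
suff -> : x' * (y / x' * (z / x') / u) = y * z / x by [].
by rewrite /u; field; rewrite x0 x'0.
Qed.

End Valuation.

Lemma exprD_div (F : fieldType) (x a : F) i k : x != 0 ->
  x ^+ (i + k) * (a / x) ^+ k = x ^+ i * a ^+ k.
Proof.
move=> x0; rewrite exprD expr_div_n -mulrA; congr (_ * _).
by rewrite mulrC divfK // expf_neq0.
Qed.

(** * Integral closedness of ideals and the Arf property in terms of values *)

Section Criterion.
Variable A : idomainType.
Local Notation f := (@tofrac A).
Local Notation B := (frac_range A).

Lemma frac_rep (z : {fraction A}) : exists a b : A, b != 0 /\ z = f a / f b.
Proof.
have repE (r : {ratio A}) : exists a b : A, b != 0 /\
    (\pi_({fraction A}) r)%qT = f a / f b.
  exists r.1, r.2; have r20 := denom_ratioP r.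
  split=> //; apply: (canRL (mulfK _)); first by rewrite tofrac_eq0.
  rewrite !piE; apply/eqP.
  rewrite FracField.equivf_def /FracField.mulf.
  by rewrite !numden_Ratio ?mulf_neq0 ?oner_neq0 //; apply/eqP; ring.
by rewrite -[z]reprK; apply: repE.
Qed.

Lemma frac_range_subring : subring_set B.
Proof.
split; first by exists 1 => //; rewrite tofrac1.
- by move=> _ _ [x _ <-] [y _ <-]; exists (x - y) => //; rewrite tofracB.
- by move=> _ _ [x _ <-] [y _ <-]; exists (x * y) => //; rewrite tofracM.
Qed.

Lemma int_closure_integral z : int_closure B z <-> integralOver f z.
Proof.
split=> [[p [mp cp rp]]|[p mp rp]].
  apply: (integral_root_monic mp rp) => c /(nthP 0)[i _ <-].
  by have [a _ <-] := cp i; apply: integral_id.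
exists (map_poly f p); split=> //; first exact: monic_map.
by move=> i; exists p`_i => //; rewrite coef_map.
Qed.

Variable w : {fraction A} -> int.
Hypothesis hw : normalized_valuation (int_closure B) w.

Lemma valuationP : normalized_valuation (int_closure B) (valuation B).
Proof. by apply: (xgetPex (fun=> 0)); exists w. Qed.

Local Notation v := (valuation B).
Let hv := valuationP.

Lemma frac_range_vge a : B a -> vge v 0 a.
Proof. by move=> /(sub_int_closure frac_range_subring) /(val_ring hv). Qed.

Lemma vge_idealX (H : set A) m k c : (forall h, H h -> vge v m (f h)) ->
  idealX H k c -> vge v (m * k%:Z) (f c).
Proof.
move=> hH; elim: k c => [|k IH] c.
  by move=> _; rewrite mulr0; apply: frac_range_vge; exists c.
case=> s hs ->; rewrite rmorph_sum big_seq; apply: (vge_sum hv) => p /hs[p1 p2].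
rewrite rmorphM /=; have := vgeM hv (hH _ p1) (IH _ p2).
by apply: vge_le; lia.
Qed.

Lemma idealX_expr (H : set A) k x : H x -> idealX H k (x ^+ k).
Proof.
move=> Hx; elim: k => [//|k IH]; exists [:: (x, x ^+ k)].
  by move=> p; rewrite inE => /eqP ->.
by rewrite big_seq1 exprS.
Qed.

Definition value_closed (H : set A) :=
  forall x a, H x -> x != 0 -> vge v (value x) (f a) -> H a.

Lemma ideal_min (H : set A) : is_ideal H -> H != [set 0] ->
  exists x, [/\ H x, x != 0 & forall y, H y -> vge v (value x) (f y)].
Proof.
move=> [H0 _ _] Hn0.
have [x0 Hx0 x00] : exists2 x0, H x0 & x0 != 0.
  apply: contrapT => hn; move/eqP: Hn0; apply; apply/seteqP; split=> [x Hx|x ->//].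
  by apply/eqP/negPn/negP => x0; apply: hn; exists x.
have [|||_ [[x Hx <-] xn0 xmin]] := @min_value _ v (f @` H) (f x0).
- by move=> _ [x _ <-]; apply: frac_range_vge; exists x.
- by exists x0.
- by rewrite tofrac_eq0.
exists x; split=> //; first by rewrite -tofrac_eq0.
by move=> y Hy; apply: xmin; exists y.
Qed.

(** If [x] in [H] has value at most that of [a], then [a / x] is integral, and its monic equation of
    degree [n] times [x ^+ n] is an integral equation for [a] over [H]. Conversely an element of
    value below the minimum of [H] satisfies no such equation, because its leading term is
    dominant. *)
Lemma integrally_closedP (H : set A) : is_ideal H -> H != [set 0] ->
  integrally_closed H <-> value_closed H.
Proof.
move=> hH Hn0; split=> [Hc x a Hx x0 va|Hc].
  have fx0 : f x != 0 by rewrite tofrac_eq0.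
  have [_ _ HM] := hH.
  have [p [mp cp rp]] : int_closure B (f a / f x).
    by apply/(val_ring hv); have := vge_div hv fx0 va; rewrite subrr.
  have cp' i : exists a', f a' = p`_i by have [a' _ <-] := cp i; exists a'.
  have [c hc] := choice cp'.
  have sp : (0 < size p)%N by rewrite size_poly_gt0 monic_neq0.
  pose n := (size p).-1.
  have en : size p = n.+1 by rewrite prednK.
  have pn : p`_n = 1 by rewrite -lead_coefE; apply/eqP.
  rewrite -Hc; exists n, (fun i => c (n - i)%N * x ^+ i); split.
  - rewrite lt0n; apply/negP => /eqP n0.
    have := rp; have : (size p <= 1)%N by rewrite en n0.
    move=> /size1_polyC ->; rewrite /root hornerC -[X in p`_X]n0 pn.
    by rewrite oner_eq0.
  - by move=> i _; have [_ _ h] := idealX_ideal H i; apply/h/idealX_expr.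
  apply/eqP; rewrite -tofrac_eq0 rmorphD rmorph_sum /= rmorphXn /=; apply/eqP.
  have : f x ^+ n * p.[f a / f x] = 0 by move/eqP: rp => ->; rewrite mulr0.
  rewrite horner_coef en -(big_mkord xpredT (fun i => p`_i * (f a / f x) ^+ i)).
  rewrite big_nat_rev add0n /= big_nat_recl // subn1 /= pn mul1r mulrDr.
  move=> h; rewrite -[RHS]h; congr (_ + _); first by rewrite expr_div_n mulrC divfK // expf_neq0.
  rewrite big_add1 /= mulr_sumr; apply: eq_big_nat => i /andP[_ iN].
  rewrite !rmorphM !rmorphXn /= hc subSS.
  have := exprD_div (f a) i.+1 (n - i.+1) fx0; rewrite subnKC // => e.
  by rewrite -mulrA -e mulrCA.
apply/seteqP; split=> [a [n [c [n0 hc ea]]]|a Ha]; last first.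
  (* An element [a] of [H] satisfies the equation of degree one with constant term [- a]. *)
  exists 1%N, (fun=> - a); split=> //.
    move=> i; rewrite -eqn_leq => /eqP <-; exists [:: (a, -1)].
      by move=> p; rewrite inE => /eqP ->.
    by rewrite big_seq1 /= mulrN1.
  by rewrite big_nat1 subnn expr0 expr1 mulr1 subrr.
have [x [Hx x0 xmin]] := ideal_min hH Hn0.
apply: (Hc x a Hx x0).
have [a0|a0] := eqVneq (f a) 0; first by left.
right; rewrite leNgt; apply/negP => lt_a.
move: ea => /(congr1 f); rewrite rmorphD rmorph_sum rmorphXn /= rmorph0 => /eqP.
rewrite addr_eq0 => /eqP ea.
(* Each other term has a factor in [H ^ i] with [i >= 1], which raises its value by at least 1 over
   that of [a ^ n]. *)
have : vge v (v (f a) * n%:Z + 1) (f a ^+ n).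
  rewrite ea; apply: (vgeN hv); rewrite big_nat; apply: (vge_sum hv) => i hi.
  rewrite rmorphM rmorphXn /=; apply: (@vge_le _ _ _ (value x * i%:Z + v (f a) * (n - i)%:Z)).
    have -> : (n - i)%:Z = n%:Z - i%:Z by lia.
    have : 0 <= (value x - v (f a) - 1) * i%:Z by apply: mulr_ge0; lia.
    by lia.
  apply: (vgeM hv); last by right; rewrite (val_exp hv).
  by apply: vge_idealX (hc i hi).
by move=> /(vgeN0 (expf_neq0 _ a0)); rewrite (val_exp hv) //; lia.
Qed.

(** Stability is applied to the ideal of all elements of value at least [v x]. In the other
    direction, for [x] of least value in [H], the quotient [y z / x] has value at least [v x], hence
    lies in [H] when [H] is integrally closed. *)
Lemma Arf_arf_set : Arf A <-> arf_set v B.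
Proof.
split=> [hA _ [x _ <-] fx0|hA H hH Hn0 Hc].
  have x0 : x != 0 by rewrite -tofrac_eq0.
  pose H : set A := [set a | vge v (value x) (f a)].
  have hH : is_ideal H.
    split; first by rewrite /H /= rmorph0; left.
    - by move=> y z; rewrite /H /= rmorphD; apply: (vgeD hv).
    - move=> a y hy; rewrite /H /= rmorphM -[value x]add0r; apply: (vgeM hv) => //.
      by apply: frac_range_vge; exists a.
  have Hx : H x by right.
  have Hn0 : H != [set 0].
    by apply/eqP => H0; move: Hx x0; rewrite H0 => -> /eqP.
  have [|x' [Hx' x'0 x'min hx']] := hA H hH Hn0.
    apply/integrally_closedP => // y a hy y0 va.
    have fy0 : f y != 0 by rewrite tofrac_eq0.
    by apply: vge_le va; apply: (vgeN0 fy0).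
  have fx'0 : f x' != 0 by rewrite tofrac_eq0.
  have e : value x = value x'.
    by apply/eqP; rewrite eq_le x'min // andbT; apply: (vgeN0 fx'0).
  (* Stability yields some generator [x'] of least value, which may differ from [x]. *)
  apply: (@arf_at_eq _ _ v B (f x) (f x') hv) => //.
  - exact: frac_range_subring.
  - exact/sub_int_closure/frac_range_subring.
  - by exists x.
  - by exists x'.
  move=> _ _ [y _ <-] [z _ <-] vy vz.
  have : setM H H (y * z).
    exists [:: (y, z)]; last by rewrite big_seq1.
    by move=> p; rewrite inE => /eqP -> /=; rewrite /H /= e.
  rewrite hx' => -[h _ eh]; exists h => //.
  by rewrite -rmorphM -eh rmorphM [_ * f h]mulrC mulfK.
have hc := (integrally_closedP hH Hn0).1 Hc.
have [x [Hx x0 xmin]] := ideal_min hH Hn0.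
have fx0 : f x != 0 by rewrite tofrac_eq0.
have [H0 HD HM] := hH.
exists x; split=> //.
  by move=> y /xmin h y0; apply: vgeN0 h; rewrite tofrac_eq0.
apply/seteqP; split=> [z [s hs ->]|_ [y Hy <-]]; last first.
  exists [:: (x, y)]; last by rewrite big_seq1.
  by move=> p; rewrite inE => /eqP ->.
rewrite big_seq; apply: big_ind.
- by exists 0 => //; rewrite mulr0.
- by move=> _ _ [y Hy <-] [z' Hz <-]; exists (y + z'); [apply: HD | rewrite mulrDr].
move=> [y z'] /hs[/= Hy Hz].
have [|||||q _ hq] := hA (f x) _ fx0 (f y) (f z'); try by [exists x | exists y | exists z'].
- exact: xmin.
- exact: xmin.
exists q; last first.
  by apply/eqP; rewrite -tofrac_eq !rmorphM /= hq mulrC divfK.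
apply: (hc x q Hx x0); rewrite hq.
have := vge_div hv fx0 (vgeM hv (xmin _ Hy) (xmin _ Hz)).
by rewrite addrK.
Qed.

End Criterion.

(** * Maximal ideal, multiplicity and blow-up of a ring satisfying the Arf condition *)

Section BlowUp.
Variables (K : fieldType) (B : set K).
Local Notation v := (valuation B).
Hypotheses (hB : subring_set B) (hv : normalized_valuation (int_closure B) v).
Hypothesis hA : arf_set v B.

Lemma subring_vge y : B y -> vge v 0 y.
Proof. by move=> /(sub_int_closure hB) /(val_ring hv). Qed.

(** For [y] of value 0, the Arf condition at [y] applied to 1 and 1 puts [1 / y] in [B]. *)
Lemma nonunitsP y : nonunits B y <-> B y /\ vge v 1 y.
Proof.
split=> [[By ny]|[By vy]]; split=> //.
  have [->|y0] := eqVneq y 0; first by left.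
  right; have := vgeN0 y0 (subring_vge By); rewrite le_eqVlt => /orP[/eqP vy|]; last by lia.
  case: ny; exists y^-1; last by rewrite divff.
  have h1 : vge v (v y) 1 by right; rewrite (val_one hv) -vy.
  by have := hA By y0 (subring1 hB) (subring1 hB) h1 h1; rewrite mulr1 mul1r.
move=> [u Bu yu].
have y0 : y != 0 by apply: contra_eq_neq yu => ->; rewrite mul0r eq_sym oner_neq0.
have u0 : u != 0 by apply: contra_eq_neq yu => ->; rewrite mulr0 eq_sym oner_neq0.
have := val_mul hv y0 u0; rewrite yu (val_one hv).
by have := vgeN0 y0 vy; have := vgeN0 u0 (subring_vge Bu); lia.
Qed.

Variable x : K.
Hypotheses (Bx : B x) (x0 : x != 0) (vx : 1 <= v x).
Hypothesis xmin : forall y, B y -> vge v 1 y -> vge v (v x) y.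

Lemma multiplicity_min : multiplicity B = v x.
Proof.
apply: xget_unique; last first.
  move=> m [[[y [By y0 <-]] /= vy] mmin].
  apply/eqP; rewrite eq_le; apply/andP; split.
    by apply: mmin; split; [exists x | move=> /= h; move: vx; rewrite h].
  apply: (vgeN0 y0); apply: xmin => //; right.
  by have := vgeN0 y0 (subring_vge By); move/eqP: vy; lia.
split; first by split; [exists x | move=> /= h; move: vx; rewrite h].
move=> _ [[y [By y0 <-]] /= vy]; apply: (vgeN0 y0); apply: xmin => //; right.
by have := vgeN0 y0 (subring_vge By); move/eqP: vy; lia.
Qed.

(* Since [n = x L] with [L] a ring containing [B], [n ^ k] lies in [x ^ k L],
   so all the [(n ^ k : n ^ k)] lie in [L = (n : n)]. *)
Lemma blowup_min : blowup B = [set z | vge v 0 z /\ B (x * z)].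
Proof.
pose L : set K := [set z | vge v 0 z /\ B (x * z)].
have vx0 : vge v (v x) x by right.
have xN : nonunits B x by apply/nonunitsP; split=> //; right.
have LM y z : L y -> L z -> L (y * z).
  move=> [vy By] [vz Bz]; split; first by have := vgeM hv vy vz.
  have -> : x * (y * z) = (x * y) * (x * z) / x by field.
  have h u : vge v 0 u -> vge v (v x) (x * u).
    by move=> /(vgeM hv vx0); rewrite addr0.
  by apply: hA => //; apply: h.
have NL y : nonunits B y -> exists2 l, L l & y = x * l.
  move=> /nonunitsP[By vy]; have e : y = x * (y / x) by rewrite mulrCA divff ?mulr1.
  exists (y / x) => //; split; last by rewrite -e.
  by have := vge_div hv x0 (xmin By vy); rewrite subrr.
have XL k (y : K) : Defs.setX B (nonunits B) k y -> exists2 l, L l & y = x ^+ k * l.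
  elim: k y => [|k IH] y.
    rewrite expr0 => Hy; have By : B y := Hy; exists y; last by rewrite mul1r.
    by split; [exact: (subring_vge By) | exact: (subringM hB Bx By)].
  case=> s hs ->; rewrite big_seq.
  apply: (big_ind (fun y => exists2 l, L l & y = x ^+ k.+1 * l)).
  - by exists 0; [split; [left | rewrite mulr0; apply: (subring0 hB)] | rewrite mulr0].
  - move=> _ _ [l [vl Bl] ->] [m [vm Bm] ->]; exists (l + m); last by rewrite mulrDr.
    by split; [exact: (vgeD hv) | rewrite mulrDr; exact: subringD].
  - move=> p /hs[/NL[l Ll ->] /IH[m Lm ->]]; exists (l * m); first exact: LM.
    by rewrite exprS; ring.
have xX k : Defs.setX B (nonunits B) k (x ^+ k).
  elim: k => [|k IH]; first by rewrite expr0; exact: subring1.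
  exists [:: (x, x ^+ k)]; last by rewrite big_seq1 exprS.
  by move=> p; rewrite inE => /eqP ->.
apply/seteqP; split=> [z [k _ [_ hz]]|z [vz Bz]].
  have [l Ll] := XL _ _ (hz _ (xX k)).
  by rewrite mulrC => /(mulfI (expf_neq0 k x0)) ->.
(* Here [k = 1] suffices. Elements of [setX B (nonunits B) 1] are sums of products of a nonunit by
   an element of [B]; after multiplication by [z] each product is itself a nonunit, paired with
   1. *)
exists 1%N => //; split; first exact/(val_ring hv).
move=> y [s hs ->]; rewrite mulr_sumr.
exists [seq (z * (p.1 * p.2), 1) | p <- s]; last first.
  by rewrite big_map; apply: eq_bigr => p _; rewrite mulr1.
move=> _ /mapP[p /hs[/nonunitsP[B1 v1] B2] ->] /=; split; last exact: subring1.
have Bp : B (p.1 * p.2) by apply: subringM.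
have vp : vge v 1 (p.1 * p.2).
  by rewrite -[1%R]addr0; apply: (vgeM hv) => //; exact: subring_vge.
apply/nonunitsP; split.
  have -> : z * (p.1 * p.2) = (x * z) * (p.1 * p.2) / x.
    by rewrite mulrAC [x * z]mulrC mulfK.
  apply: hA => //; last exact: xmin.
  by rewrite -[v x]addr0; apply: (vgeM hv).
by rewrite -[1%R]add0r; apply: (vgeM hv).
Qed.

End BlowUp.

(** * The chain of blow-ups, the values of an Arf ring and its conductor *)

Section Chain.
Variables (K : fieldType) (R : set K).
Local Notation v := (valuation R).
Hypotheses (hR : subring_set R) (hv : normalized_valuation (int_closure R) v).
Hypothesis hA : arf_set v R.
Variable c0 : int.
Hypothesis hc0 : forall z, vge v c0 z -> R z.

(** Every ring of the blow-up chain has this form ([mult_chain]), so questions about iterated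
    blow-ups reduce to questions about [R]. *)
Definition quot_ring d : set K := [set z | vge v 0 z /\ R (d * z)].

Section QuotRing.
Variable d : K.
Hypotheses (Rd : R d) (d0 : d != 0).

Lemma sub_quot_ring : R `<=` quot_ring d.
Proof. by move=> a Ra; split; [exact: (subring_vge hR hv) | exact: (subringM hR)]. Qed.

(** Closure under products is the Arf condition on [R] at [d]. *)
Lemma quot_ring_subring : subring_set (quot_ring d).
Proof.
split; first by apply: sub_quot_ring; exact: (subring1 hR).
  move=> y z [vy Ry] [vz Rz]; split; first exact: (vgeB hv).
  by rewrite mulrBr; apply: subringB.
move=> y z [vy Ry] [vz Rz]; split; first by have := vgeM hv vy vz.
have -> : d * (y * z) = (d * y) * (d * z) / d by field.
have h u : vge v 0 u -> vge v (v d) (d * u).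
  by move=> /(vgeM hv (vge_self v d)); rewrite addr0.
by apply: hA => //; apply: h.
Qed.

Lemma quot_ring_int_closure : int_closure (quot_ring d) = int_closure R.
Proof.
apply/seteqP; split; first by apply: (int_closure_sub hv) => z [/(val_ring hv)].
move=> z [p [mp cp rp]]; exists p; split=> // i.
exact: sub_quot_ring.
Qed.

Lemma quot_ring_valuation : valuation (quot_ring d) = v.
Proof. by rewrite /valuation quot_ring_int_closure. Qed.

(** Multiplication by [d] turns the condition at [x] into the condition on [R] at [d * x]. *)
Lemma quot_ring_arf : arf_set (valuation (quot_ring d)) (quot_ring d).
Proof.
rewrite quot_ring_valuation => x [vx Rx] x0 y z [vy Ry] [vz Rz] vxy vxz.
split.
  have := vge_div hv x0 (vgeM hv vxy vz); rewrite addr0 subrr.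
  by [].
have -> : d * (y * z / x) = (d * y) * (d * z) / (d * x) by field; rewrite d0 x0.
have dx : v (d * x) = v d + v x by rewrite (val_mul hv).
apply: hA => //; rewrite ?mulf_neq0 // dx; apply: (vgeM hv) => //; exact: vge_self.
Qed.

(** With [x] of least positive value, the blow-up consists of the integral [z] with [x z] in
    [quot_ring d], that is with [d x z] in [R]: blowing up only changes the denominator. *)
Lemma quot_ring_step : exists x, [/\ x != 0, quot_ring d x,
  multiplicity (quot_ring d) = v x, 1 <= v x &
  (forall y, quot_ring d y -> vge v 1 y -> vge v (v x) y) /\
  blowup (quot_ring d) = quot_ring (d * x)].
Proof.
(* This value is positive and past the bound [c0], so positive values do occur. *)
have [y y0 vy] := val_exists hv (`|c0| + 1).
have Qy : quot_ring d y by apply/sub_quot_ring/hc0; right; rewrite vy; lia.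
have [|||x [[Qx vx1] x0 xmin]] :=
    @min_value _ v [set z | quot_ring d z /\ vge v 1 z] y.
- by move=> z [_]; apply: vge_le.
- by split=> //; right; rewrite vy; lia.
- by [].
have hvQ : normalized_valuation (int_closure (quot_ring d)) (valuation (quot_ring d)).
  by rewrite quot_ring_valuation quot_ring_int_closure.
have xmin' z : quot_ring d z -> vge v 1 z -> vge v (v x) z.
  by move=> Qz vz; apply: xmin.
have vx := vgeN0 x0 vx1.
have m := @multiplicity_min _ _ quot_ring_subring hvQ x Qx x0.
have bl := @blowup_min _ _ quot_ring_subring hvQ quot_ring_arf x Qx x0.
rewrite quot_ring_valuation in m bl.
exists x; split=> //; first exact: m.
split=> //; rewrite bl //; apply/seteqP; split=> z.
  by move=> [vz [_ Rz]]; split=> //; rewrite -mulrA.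
move=> [vz Rz]; split=> //; split; last by rewrite mulrA.
by rewrite -[0]addr0; apply: (vgeM hv) => //; case: Qx.
Qed.

End QuotRing.

Local Notation e := (mult_seq R).
(** These partial sums are exactly the values of [R]: each is attained by [mult_chain], and
    [value_mult_sum] shows that there are no others. *)
Definition mult_sum (k : nat) : int := \sum_(i < k) mult_seq R i.
Local Notation s := mult_sum.

Lemma mult_sumS k : s k.+1 = s k + e k.
Proof. by rewrite /mult_sum big_ord_recr. Qed.

Lemma mult_chain k : exists d, [/\ R d, d != 0, v d = s k &
  iter k (@blowup K) R = quot_ring d].
Proof.
elim: k => [|k [d [Rd d0 vd hd]]].
  exists 1; split; rewrite ?oner_neq0 //; first exact: subring1.
    by rewrite (val_one hv) /mult_sum big_ord0.
  apply/seteqP; split=> z /=; last by case; rewrite mul1r.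
  by move=> Rz; apply: sub_quot_ring => //; exact: subring1.
have [x [x0 [vx0 Rdx] mx _ [_ bx]]] := quot_ring_step Rd d0.
exists (d * x); split; rewrite ?mulf_neq0 //; last by rewrite iterS hd bx.
by rewrite (val_mul hv) // vd mult_sumS /mult_seq hd mx.
Qed.

(** If [d] has value [s k] and defines the [k]-th ring, then [r / d] lies in that ring with positive
    value, hence with value at least its multiplicity [e k]. *)
Lemma mult_seq_next k : 1 <= e k /\
  forall r, R r -> r != 0 -> s k < v r -> s k.+1 <= v r.
Proof.
have [d [Rd d0 vd hd]] := mult_chain k.
have [x [x0 [vx0 Rdx] mx vx [xmin _]]] := quot_ring_step Rd d0.
have ek : e k = v x by rewrite /mult_seq hd mx.
split=> [|r Rr r0 lt_r]; first by rewrite ek.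
have rd0 : r / d != 0 by rewrite mulf_neq0 ?invr_neq0.
have vrd : vge v 1 (r / d) by right; rewrite (val_div hv) // vd; lia.
have := xmin (r / d) _ vrd; rewrite mult_sumS ek => h.
have Q : quot_ring d (r / d).
  by split; [apply: vge_le vrd | rewrite mulrCA divff // mulr1].
by have := vgeN0 rd0 (h Q); rewrite (val_div hv) // vd; lia.
Qed.

Lemma mult_seq_ge1 k : 1 <= e k. Proof. by have [] := mult_seq_next k. Qed.

Lemma mult_sum_next k r : R r -> r != 0 -> s k < v r -> s k.+1 <= v r.
Proof. by have [_] := mult_seq_next k; apply. Qed.

Lemma mult_sum_ge k : k%:Z <= s k.
Proof.
elim: k => [|k IH]; first by rewrite /mult_sum big_ord0.
by rewrite mult_sumS; have := mult_seq_ge1 k; lia.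
Qed.

Lemma mult_sum_le j k : (j <= k)%N -> s j <= s k.
Proof.
move=> /subnKC <-; elim: (k - j)%N => [|i IH]; first by rewrite addn0.
by rewrite addnS mult_sumS; have := mult_seq_ge1 (j + i); lia.
Qed.

Lemma value_mult_sum r : R r -> r != 0 -> exists k, v r = s k.
Proof.
move=> Rr r0; have vr := vgeN0 r0 (subring_vge hR hv Rr).
have : exists k, v r < s k by exists (`|v r|.+1)%N; have := mult_sum_ge (`|v r|.+1); lia.
move=> /ex_minnP[[|k]]; first by rewrite /mult_sum big_ord0; lia.
move=> lt_k kmin; exists k; apply/eqP; rewrite eq_le; apply/andP; split.
  by rewrite leNgt; apply/negP => /(mult_sum_next Rr r0); lia.
by rewrite leNgt; apply/negP => /kmin; rewrite ltnn.
Qed.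

(** For [d], [d'] of values [s k], [s k.+1], the Arf condition puts [d' ^ 2 / d] in [R]. Its value
    [s k.+1 + e k] exceeds [s k.+1], so it is at least [s k.+1 + e k.+1]. *)
Lemma mult_seq_noninc j k : (j <= k)%N -> e k <= e j.
Proof.
move=> /subnKC <-; elim: (k - j)%N => [|i IH]; first by rewrite addn0.
apply: le_trans IH; rewrite addnS; move: (j + i)%N => {j i} k.
have [d [Rd d0 vd _]] := mult_chain k.
have [d' [Rd' d'0 vd' _]] := mult_chain k.+1.
have dd' : vge v (v d) d' by right; rewrite vd vd' mult_sumS; have := mult_seq_ge1 k; lia.
have Rr := hA Rd d0 Rd' Rd' dd' dd'.
have r0 : d' * d' / d != 0 by rewrite !mulf_neq0 ?invr_neq0.
have vr : v (d' * d' / d) = v d' + v d' - v d by rewrite (val_div hv) ?mulf_neq0 // (val_mul hv).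
have := @mult_sum_next k.+1 _ Rr r0.
by rewrite vr vd vd' (mult_sumS k.+1) (mult_sumS k); have := mult_seq_ge1 k; lia.
Qed.

(** For [k] past [c0], the integer [s k + 1] is a value of [R], which leaves no room for [e k > 1].
    The least such bound [n] satisfies the last clause. *)
Lemma mult_seq_eventually1 : exists n,
  (forall k, (n <= k)%N -> e k = 1) /\ ((0 < n)%N -> e n.-1 <> 1).
Proof.
have ex : exists n, `[< forall k, (n <= k)%N -> e k = 1 >].
  exists `|c0|%N; apply/asboolP => k hk.
  have [y y0 vy] := val_exists hv (s k + 1).
  have ks := mult_sum_ge k.
  have Ry : R y by apply: hc0; right; rewrite vy; lia.
  have := mult_sum_next (k := k) Ry y0; rewrite vy mult_sumS.
  by have := mult_seq_ge1 k; lia.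
case: (ex_minnP ex) => n /asboolP n1 nmin; exists n; split=> // n0 en.
suff : (n <= n.-1)%N by lia.
apply: nmin; apply/asboolP => k hk.
by have [->//|] := eqVneq k n.-1 => ?; apply: n1; lia.
Qed.

Variable n : nat.

(** If [v z < s n], then [R] contains an element of value [s n - 1]; as [e n.-1 >= 2], this value
    falls strictly between two consecutive sums. *)
Lemma mult_sum_min z : ((0 < n)%N -> e n.-1 <> 1) -> z != 0 ->
  (forall y, vge v (v z) y -> R y) -> s n <= v z.
Proof.
move=> hn z0 hz; have Rz : R z by apply: hz; right.
have vz := vgeN0 z0 (subring_vge hR hv Rz).
case: n hn => [|m] hm; first by rewrite /mult_sum big_ord0.
rewrite leNgt; apply/negP => lt_z.
have [y y0 vy] := val_exists hv (s m.+1 - 1).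
have Ry : R y by apply: hz; right; rewrite vy; lia.
have := mult_sum_next (k := m) Ry y0; rewrite vy mult_sumS.
by have := hm isT; have := mult_seq_ge1 m; rewrite /=; lia.
Qed.

Hypothesis hn1 : forall k, (n <= k)%N -> e k = 1.
Hypothesis hres : forall z, vge v 0 z -> exists2 a, R a & vge v 1 (z - a).

(* Successive approximation: [z - a r] has larger value than [z] when [r] in [R]
   has the value of [z] and [a] the residue of [z / r]. *)
Lemma mult_sum_conductor z : vge v (s n) z -> R z.
Proof.
have [k] : exists k : nat, vge v (c0 - k%:Z) z \/ z = 0.
  by exists `|c0 - v z|%N; left; right; lia.
move=> hk hz; have {hk} : vge v (c0 - k%:Z) z by case: hk => // ->; left.
elim: k z hz => [|k IH] z hz hk; first by apply: hc0; rewrite subr0 in hk.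
have [->|z0] := eqVneq z 0; first exact: subring0.
have sz := vgeN0 z0 hz.
(* All multiplicities from index [n] on are 1, so every integer from [s n] on is a value of [R]. *)
have [r [Rr r0 vr]] : exists r, [/\ R r, r != 0 & v r = v z].
  have [d [Rd d0 vd _]] := mult_chain (n + `|v z - s n|).
  exists d; split=> //; rewrite vd.
  have aux i : s (n + i) = s n + i%:Z.
    elim: i => [|i IHi]; first by rewrite addn0 addr0.
    by rewrite addnS mult_sumS IHi hn1 ?leq_addr //; lia.
  by rewrite aux; lia.
have vzr : vge v 0 (z / r) by right; rewrite (val_div hv) // vr subrr.
have [a Ra va] := hres vzr.
have vza : vge v (v z + 1) (z - a * r).
  have -> : z - a * r = r * (z / r - a) by field.
  by rewrite -vr; apply: (vgeM hv) => //; exact: vge_self.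
have -> : z = (z - a * r) + a * r by rewrite subrK.
apply: subringD => //; last exact: subringM.
apply: IH; apply: vge_le vza; first by lia.
by have := vgeN0 z0 hk; lia.
Qed.

(** The two preceding lemmas identify the conductor with the elements of value at least [s n]. An
    ideal closed under larger values contains it properly as soon as it has one nonzero element
    below that bound. *)
Lemma conductor_proper (I : set K) : ((0 < n)%N -> e n.-1 <> 1) ->
  I 0 -> value_ideal v R I ->
  (colon R R (int_closure R) `<` I) <-> exists i, [/\ I i, i != 0 & v i < s n].
Proof.
move=> hn I0 hI; have inC z : z != 0 -> colon R R (int_closure R) z <-> s n <= v z.
  move=> z0; split=> [[_ hz]|nz].
    apply: (mult_sum_min hn z0) => y vy.
    have -> : y = z * (y / z) by rewrite mulrCA divff // mulr1.
    by apply: hz; apply/(val_ring hv); have := vge_div hv z0 vy; rewrite subrr.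
  have vz : vge v (s n) z by right.
  split; first by apply: (sub_int_closure hR); exact: mult_sum_conductor.
  by move=> y /(val_ring hv) vy; apply: mult_sum_conductor; have := vgeM hv vz vy; rewrite addr0.
split=> [[_ hn']|[i [Ii i0 lt_i]]].
  apply: contrapT => hno; apply: hn' => i Ii.
  have [->|i0] := eqVneq i 0.
    split; first by apply: (sub_int_closure hR); exact: (subring0 hR).
    by move=> y _; rewrite mul0r; exact: (subring0 hR).
  apply/(inC i i0); rewrite leNgt; apply/negP => lt_i.
  by apply: hno; exists i.
split=> [z Cz|]; last by move=> /(_ i Ii) /(inC i i0); lia.
have [->//|z0] := eqVneq z 0; have nz := (inC z z0).1 Cz.
by apply: (hI i z Ii i0); [apply: mult_sum_conductor; right | right; lia].
Qed.

End Chain.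

(** * The quadratic extension [L = K + K th]: its valuation and the order [R + I th] *)

Lemma integralOver_quadratic (A : comNzRingType) (L : fieldType)
  (f : {rmorphism A -> L}) (z t n : L) : integralOver f t -> integralOver f n ->
  z ^+ 2 - t * z + n = 0 -> integralOver f z.
Proof.
move=> it inn ez; pose p : {poly L} := 'X^2 - (t *: 'X - n%:P).
have mp : p \is monic.
  rewrite /p monicE lead_coefDl ?lead_coefXn // size_polyN size_polyXn.
  have st : (size (t *: 'X : {poly L}) < 3)%N.
    by apply: leq_ltn_trans (size_scale_leq _ _) _; rewrite size_polyX.
  apply: leq_ltn_trans (size_polyD _ _) _; rewrite gtn_max st size_polyN.
  by apply: leq_ltn_trans (size_polyC_leq1 _) _.
apply: (integral_root_monic mp).
  by rewrite /root /p !hornerE opprB addrA addrAC ez.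
apply/integral_poly => i; rewrite /p !coefB coefXn coefZ coefX coefC.
apply: integral_sub; first exact: integral_nat.
apply: integral_sub; first by apply: integral_mul => //; exact: integral_nat.
by case: ifP => // _; exact: integral0.
Qed.

Lemma val_add_lt (F : fieldType) (V : set F) v (x y : F) :
  normalized_valuation V v -> x != 0 -> y != 0 -> v x < v y ->
  x + y != 0 /\ v (x + y) = v x.
Proof.
move=> hv x0 y0 lt_xy.
have s0 : x + y != 0.
  by apply: contraTneq lt_xy => /eqP; rewrite addr_eq0 => /eqP ->; rewrite (val_opp hv) ?ltxx.
split=> //; have h1 : vge v (v x) (x + y).
  by apply: (vgeD hv); [exact: vge_self | right; apply: ltW].
apply/eqP; rewrite eq_le (vgeN0 s0 h1) andbT leNgt; apply/negP => lt_s.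
have : vge v (v x + 1) (x + y - y) by apply: (vgeB hv); right; lia.
by rewrite addrK => /(vgeN0 x0); lia.
Qed.

Section Quadratic.
Variables (K L : fieldType) (io : {rmorphism K -> L}) (th : L) (b : K).
Hypotheses (hth : th ^+ 2 = io b)
  (hgen : forall l, exists x y, l = io x + io y * th).
Variables (V : set K) (v : K -> int).
Hypothesis hv : normalized_valuation V v.
Hypotheses (b0 : b != 0) (vb_odd : odd `|v b|%N).

Definition quad x y : L := io x + io y * th.

Lemma quadD x y x' y' : quad x y + quad x' y' = quad (x + x') (y + y').
Proof. by rewrite /quad !rmorphD /=; ring. Qed.

Lemma quadM x y x' y' :
  quad x y * quad x' y' = quad (x * x' + b * (y * y')) (x * y' + y * x').
Proof. by rewrite /quad !rmorphD !rmorphM /= -hth; ring. Qed.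

Lemma quad_io x : io x = quad x 0.
Proof. by rewrite /quad rmorph0 mul0r addr0. Qed.

Lemma quad_th y : io y * th = quad 0 y.
Proof. by rewrite /quad rmorph0 add0r. Qed.

Lemma quad0 : quad 0 0 = 0. Proof. by rewrite -quad_io rmorph0. Qed.

(** The inequality [w >= m] for one coordinate: [n] is 0 for [x] and [v b] for [x th], since [w]
    doubles [v] on [K] and [w th = v b]. *)
Definition vge2 (m n : int) x := x = 0 \/ m <= v x + v x + n.

Lemma vge2D (m n : int) x y : vge2 m n x -> vge2 m n y -> vge2 m n (x + y).
Proof.
have [->|x0] := eqVneq x 0; first by rewrite add0r.
have [->|y0] := eqVneq y 0; first by rewrite addr0.
move=> [/eqP|hx]; first by rewrite (negPf x0).
move=> [/eqP|hy]; first by rewrite (negPf y0).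
have [->|s0] := eqVneq (x + y) 0; first by left.
have hm : vge v (Num.min (v x) (v y)) (x + y).
  by apply: (vgeD hv); right; rewrite ge_min lexx ?orbT.
by right; have := vgeN0 s0 hm; rewrite ge_min => /orP[] h; lia.
Qed.

(** The norm of [x + y th] over [K]; the valuation of [L] is [v] of this norm. *)
Definition qnorm x y := x ^+ 2 - b * y ^+ 2.

(* The two terms of the norm have values of different parities. *)
Lemma qnorm_val (m : int) x y : (x != 0) || (y != 0) ->
  qnorm x y != 0 /\ (m <= v (qnorm x y) <-> vge2 m 0 x /\ vge2 m (v b) y).
Proof.
have vx2 z : z != 0 -> v (z ^+ 2) = v z + v z.
  by move=> z0; rewrite expr2 (val_mul hv).
have vby z : z != 0 -> v (- (b * z ^+ 2)) = v z + v z + v b.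
  move=> z0; rewrite (val_opp hv) ?mulf_neq0 ?expf_neq0 // (val_mul hv) ?expf_neq0 //.
  by rewrite vx2 // addrC.
rewrite /qnorm; have [->|x0] /= := eqVneq x 0.
  move=> y0; rewrite expr0n sub0r vby // oppr_eq0 mulf_neq0 ?expf_neq0 //.
  split=> //; split=> [h|[_ [/eqP|//]]]; last by rewrite (negPf y0).
  by split; [left | right].
move=> _; have [->|y0] := eqVneq y 0.
  rewrite expr0n mulr0 subr0 vx2 // expf_neq0 //; split=> //.
  split=> [h|[[/eqP|]]]; last by rewrite addr0.
    by split; [right; rewrite addr0 | left].
  by rewrite (negPf x0).
have x20 : x ^+ 2 != 0 by rewrite expf_neq0.
have y20 : - (b * y ^+ 2) != 0 by rewrite oppr_eq0 mulf_neq0 ?expf_neq0.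
have iff_min k : k = Num.min (v x + v x) (v y + v y + v b) ->
    (m <= k <-> vge2 m 0 x /\ vge2 m (v b) y).
  move=> ->; rewrite le_min; split=> [/andP[h1 h2]|[h1 h2]].
    by split; right; rewrite ?addr0.
  case: h1 => [/eqP|h1]; first by rewrite (negPf x0).
  case: h2 => [/eqP|h2]; first by rewrite (negPf y0).
  by rewrite -[v x + v x]addr0 h1 h2.
have [lt|lt|e] := ltgtP (v (x ^+ 2)) (v (- (b * y ^+ 2))).
- have [n0 ->] := val_add_lt hv x20 y20 lt; split=> //; apply: iff_min.
  by move: lt; rewrite vx2 // vby //; lia.
- rewrite addrC; have [n0 ->] := val_add_lt hv y20 x20 lt; split=> //; apply: iff_min.
  by move: lt; rewrite vx2 // vby //; lia.
move: e vb_odd; rewrite vx2 // vby // => e ob; exfalso; lia.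
Qed.

(** A zero element has zero norm, and the norm vanishes only at [x = y = 0]. *)
Lemma quad_eq0 x y : quad x y = 0 -> x = 0 /\ y = 0.
Proof.
move=> h; have : quad x y * quad x (- y) = 0 by rewrite h mul0r.
rewrite quadM.
have -> : x * - y + y * x = 0 by ring.
have -> : x * x + b * (y * - y) = qnorm x y by rewrite /qnorm; ring.
rewrite -quad_io => /eqP; rewrite fmorph_eq0 => n0.
have [->|x0] := eqVneq x 0; last by have [] := @qnorm_val 0 x y; rewrite ?x0 ?(eqP n0) ?eqxx.
have [->|y0] := eqVneq y 0; first by [].
by have [] := @qnorm_val 0 x y; rewrite ?y0 ?orbT ?(eqP n0) ?eqxx.
Qed.

Lemma quad_root x y :
  quad x y ^+ 2 - io (x + x) * quad x y + io (qnorm x y) = 0.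
Proof. by rewrite /quad /qnorm rmorphB (rmorphM _ b) !rmorphXn rmorphD /= -hth; ring. Qed.

Lemma quad_inv x y : quad x y != 0 ->
  (quad x y)^-1 = quad (x / qnorm x y) (- y / qnorm x y).
Proof.
move=> q0; have n0 : qnorm x y != 0.
  have [] := @qnorm_val 0 x y; last by [].
  by apply: contraR q0; rewrite negb_or !negbK => /andP[/eqP -> /eqP ->]; rewrite quad0.
apply: (mulfI q0); rewrite divff // quadM.
have -> : x * (x / qnorm x y) + b * (y * (- y / qnorm x y)) = qnorm x y / qnorm x y.
  by rewrite {3}/qnorm; ring.
have -> : x * (- y / qnorm x y) + y * (x / qnorm x y) = 0 by ring.
by rewrite divff // -quad_io rmorph1.
Qed.

Lemma quad_inj x y x' y' : quad x y = quad x' y' -> x = x' /\ y = y'.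
Proof.
move=> h; have : quad (x - x') (y - y') = 0.
  have -> : quad (x - x') (y - y') = quad x y - quad x' y'.
    by rewrite /quad !rmorphB /=; ring.
  by rewrite h subrr.
by move=> /quad_eq0[/eqP + /eqP]; rewrite !subr_eq0 => /eqP -> /eqP ->.
Qed.

(** Multiplicativity comes from that of the norm, and the ultrametric inequality from the
    coordinatewise description of [w]. *)
Lemma quad_valuation : exists w : L -> int,
  normalized_valuation [set l | l = 0 \/ 0 <= w l] w /\
  forall m x y, vge w m (quad x y) <-> vge2 m 0 x /\ vge2 m (v b) y.
Proof.
have [X hX] := choice hgen; have [Y hY] := choice hX.
pose w l := v (qnorm (X l) (Y l)).
have lE l : l = quad (X l) (Y l) by exact: hY.
have XYE x y : X (quad x y) = x /\ Y (quad x y) = y.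
  by have [] := quad_inj (lE (quad x y)).
have wE x y : w (quad x y) = v (qnorm x y) by rewrite /w; have [-> ->] := XYE x y.
have n0 l : l != 0 -> (X l != 0) || (Y l != 0).
  by apply: contraR; rewrite negb_or !negbK => /andP[/eqP h1 /eqP h2]; rewrite (lE l) h1 h2 quad0.
have hw m x y : vge w m (quad x y) <-> vge2 m 0 x /\ vge2 m (v b) y.
  have [xy|] := boolP ((x != 0) || (y != 0)).
    have [q0 <-] := qnorm_val m xy; rewrite -wE; split=> [[/quad_eq0[h1 h2]|//]|]; last by right.
    by move: xy; rewrite h1 h2 eqxx.
  rewrite negb_or !negbK => /andP[/eqP -> /eqP ->].
  by split=> _; [split; left | left; exact: quad0].
exists w; split=> //; split=> //.
- move=> l l' l0 l'0; rewrite {1}(lE l) {1}(lE l') quadM wE.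
  have [q0 _] := qnorm_val 0 (n0 _ l0); have [q'0 _] := qnorm_val 0 (n0 _ l'0).
  by rewrite /w -(val_mul hv) //; congr v; rewrite /qnorm; ring.
- move=> l l' l0 l'0 s0; set m := Num.min _ _.
  have ge k : k != 0 -> m <= w k -> vge2 m 0 (X k) /\ vge2 m (v b) (Y k).
    by move=> k0 mk; apply/hw; rewrite -lE; right.
  have [] := ge l l0; first by rewrite ge_min lexx.
  have [] := ge l' l'0; first by rewrite ge_min lexx orbT.
  move=> h1 h2 h3 h4; apply: (vgeN0 s0).
  by rewrite (lE l) (lE l') quadD; apply/hw; split; apply: vge2D.
(* As [v b] is odd, an even [m] is attained on [K] and an odd one on [K th]. *)
- move=> m; have [j] : exists j, m = j + j \/ m = j + j + v b.
    by exists ((m - (if odd `|m|%N then v b else 0)) %/ 2)%Z; case: ifP vb_odd; lia.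
  have [z z0 vz] := val_exists hv j.
  have z20 : v (z ^+ 2) = j + j by rewrite expr2 (val_mul hv) // vz.
  case=> ->; [exists (quad z 0) | exists (quad 0 z)].
  + by apply: contra_neq z0 => /quad_eq0[].
  + by rewrite wE /qnorm expr0n mulr0 subr0.
  + by apply: contra_neq z0 => /quad_eq0[].
  + rewrite wE /qnorm expr0n sub0r (val_opp hv) ?mulf_neq0 ?expf_neq0 //.
    by rewrite (val_mul hv) ?expf_neq0 // z20 addrC.
Qed.

Section QuadraticArf.
Variable w : L -> int.
Hypothesis hw : forall m x y, vge w m (quad x y) <-> vge2 m 0 x /\ vge2 m (v b) y.
Variables (W : set L) (R I : set K).
Hypothesis hwW : normalized_valuation W w.
Hypotheses (hR : subring_set R) (Rb : R b).
Hypotheses (IR : I `<=` R) (I0 : I 0) (ID : forall x y, I x -> I y -> I (x + y))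
  (IM : forall a x, R a -> I x -> I (a * x)).

Definition quad_order : set L := [set l | exists x y, [/\ R x, I y & l = quad x y]].
Local Notation S := quad_order.
Local Notation value_ideal := (value_ideal v R I).

Lemma quad_orderE x y : S (quad x y) <-> R x /\ I y.
Proof.
split=> [[x' [y' [Rx Iy /quad_inj[-> ->]]]]|[Rx Iy]] //.
by exists x, y.
Qed.

Lemma quad_order_subring : subring_set S.
Proof.
split.
- exists 1, 0; split=> //; first exact: (subring1 hR).
  by rewrite -quad_io rmorph1.
- move=> _ _ [x [y [Rx Iy ->]]] [x' [y' [Rx' Iy' ->]]].
  have -> : quad x y - quad x' y' = quad (x - x') (y + -1 * y').
    by rewrite /quad !rmorphD rmorphM !rmorphN rmorph1 /=; ring.
  apply/quad_orderE; split; first exact: (subringB hR).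
  by apply: ID => //; apply: IM => //; apply: subringN => //; exact: subring1.
- move=> _ _ [x [y [Rx Iy ->]]] [x' [y' [Rx' Iy' ->]]].
  rewrite quadM; apply/quad_orderE; split.
    by apply: subringD => //; apply: subringM => //; apply: subringM => //; exact: IR.
  by apply: ID; [exact: IM | rewrite mulrC; exact: IM].
Qed.

Lemma w_io x : x != 0 -> w (io x) = v x + v x.
Proof.
move=> x0; have q0 : quad x 0 != 0 by apply: contra_neq x0 => /quad_eq0[].
rewrite quad_io; apply/eqP; rewrite eq_le; apply/andP; split.
  have [[h|h] _] := (hw (w (quad x 0)) x 0).1 (vge_self _ _).
    by rewrite h eqxx in x0.
  by rewrite addr0 in h.
by apply: (vgeN0 q0); apply/hw; split; [right; rewrite addr0 | left].
Qed.

Lemma w_io_th y : y != 0 -> w (io y * th) = v y + v y + v b.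
Proof.
move=> y0; have q0 : quad 0 y != 0 by apply: contra_neq y0 => /quad_eq0[].
rewrite quad_th; apply/eqP; rewrite eq_le; apply/andP; split.
  by have [_ [/eqP|//]] := (hw (w (quad 0 y)) 0 y).1 (vge_self _ _); rewrite (negPf y0).
by apply: (vgeN0 q0); apply/hw; split; [left | right].
Qed.

Lemma vge_io m x : vge w (m + m) (io x) <-> vge v m x.
Proof.
rewrite quad_io; split=> [/hw[[->|h] _]|[->|h]]; try by [left].
- by right; lia.
- by rewrite quad0; left.
- by apply/hw; split; [right; lia | left].
Qed.

Lemma th0 : th != 0.
Proof. by apply: contra_neq b0 => h; apply/eqP; rewrite -(fmorph_eq0 io) -hth h expr0n. Qed.

Section Forward.
Hypothesis hS : arf_set w S.

Lemma quad_arf_base : arf_set v R.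
Proof.
move=> x Rx x0 y z Ry Rz vy vz.
have S1 a : R a -> S (io a) by move=> Ra; rewrite quad_io; apply/quad_orderE.
have iox0 : io x != 0 by rewrite fmorph_eq0.
have := hS (S1 x Rx) iox0 (S1 y Ry) (S1 z Rz).
rewrite w_io // => /(_ ((vge_io _ _).2 vy) ((vge_io _ _).2 vz)).
by rewrite -fmorphV -!rmorphM quad_io => /quad_orderE[].
Qed.

(** The condition at [i], applied to [i th] and [a], puts [a th] in [S]. *)
Lemma quad_arf_ideal : 1 <= v b -> value_ideal.
Proof.
move=> vb i a Ii i0 Ra va.
have Si : S (io i) by rewrite quad_io; apply/quad_orderE; split=> //; exact: IR.
have Sa : S (io a) by rewrite quad_io; apply/quad_orderE.
have Sit : S (io i * th).
  by rewrite quad_th; apply/quad_orderE; split=> //; exact: (subring0 hR).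
have ioi0 : io i != 0 by rewrite fmorph_eq0.
have := hS Si ioi0 Sit Sa; rewrite w_io // => /(_ _ ((vge_io _ _).2 va)).
have -> : io i * th * io a / io i = io a * th by field.
have hit : vge w (v i + v i) (io i * th).
  by right; rewrite w_io_th //; lia.
by move=> /(_ hit); rewrite quad_th => /quad_orderE[].
Qed.

(** The condition at [d th], applied to [y] twice, has quotient [y ^ 2 / (d th)], which is
    [y ^ 2 / (d b)] times [th]. *)
Lemma quad_arf_sqr d y : I d -> d != 0 -> R y -> vge2 (v d + v d + v b) 0 y ->
  I (y * y / (d * b)).
Proof.
move=> Id d0 Ry vy.
have Sy : S (io y) by rewrite quad_io; apply/quad_orderE.
have Sd : S (io d * th).
  by rewrite quad_th; apply/quad_orderE; split=> //; exact: (subring0 hR).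
have iod0 : io d != 0 by rewrite fmorph_eq0.
have dt0 : io d * th != 0 by rewrite mulf_neq0 ?th0.
have vy' : vge w (w (io d * th)) (io y).
  by rewrite w_io_th // quad_io; apply/hw; split=> //; left.
have := hS Sd dt0 Sy Sy vy' vy'.
have -> : io y * io y / (io d * th) = io (y * y / (d * b)) * th.
  rewrite !rmorphM fmorphV rmorphM /= -hth; field.
  by rewrite th0 iod0.
by rewrite quad_th => /quad_orderE[].
Qed.

End Forward.

Section Backward.
Hypotheses (hA : arf_set v R) (hI : value_ideal) (vb : 1 <= v b).
Variable c : int.
Hypothesis hc : forall z, vge v c z -> R z.
(** The premises of [gap0] and [gap1] compare [r] with [i th] in [L]. Both reflect that, for
    [v i < c], no value of [R] lies strictly between [v i] and [v i + v b]. *)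
Hypothesis gap0 : forall i r, I i -> i != 0 -> R r -> r != 0 ->
  v r + v r <= v i + v i + v b -> v r <= v i \/ c <= v i.
Hypothesis gap1 : forall i r, I i -> i != 0 -> R r -> r != 0 ->
  v i + v i + v b <= v r + v r -> v i + v b <= v r \/ c <= v i.

Lemma ideal_absorb i z : I i -> i != 0 -> vge v (v i) z -> c <= v i \/ R z -> I z.
Proof.
move=> Ii i0 vz h; apply: (hI Ii i0) => //; case: h => // ci.
by apply: hc; apply: vge_le vz.
Qed.

(** For a coordinate [i] in [I], [gap0] gives either [v x <= v i], so that the Arf condition on [R]
    at [x] applies, or [c <= v i], so that the term has value at least [c]. *)
Lemma arf_at_base x : R x -> x != 0 -> arf_at w S (io x).
Proof.
move=> Rx x0 _ _ [y0 [y1 [Ry0 Iy1 ->]]] [z0 [z1 [Rz0 Iz1 ->]]].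
rewrite w_io // => /hw[vy0 vy1] /hw[vz0 vz1].
have Iv i r : I i -> vge2 (v x + v x) (v b) i -> R r -> vge2 (v x + v x) 0 r ->
    I (r * i / x).
  move=> Ii vi Rr vr.
  have [->|i0] := eqVneq i 0; first by rewrite mulr0 mul0r.
  have [->|r0] := eqVneq r 0; first by rewrite !mul0r.
  case: vi => [/eqP|vi]; first by rewrite (negPf i0).
  case: vr => [/eqP|vr]; first by rewrite (negPf r0).
  apply: (ideal_absorb Ii i0).
    by right; rewrite (val_div hv) ?mulf_neq0 // (val_mul hv) //; lia.
  have [xi|ci] := gap0 Ii i0 Rx x0 vi; last by left.
  by right; apply: hA => //; [exact: IR | right; lia | right].
have -> : quad y0 y1 * quad z0 z1 / io x =
    quad (y0 * z0 / x + b * (y1 * z1) / x) (y0 * z1 / x + z0 * y1 / x).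
  by rewrite quadM /quad !rmorphD !rmorphM !fmorphV /=; field; rewrite fmorph_eq0.
have vge_half r : vge2 (v x + v x) 0 r -> vge v (v x) r.
  by move=> [->|h]; [left | right; lia].
apply/quad_orderE; split; last by apply: ID; apply: Iv.
apply: subringD => //; first by apply: hA => //; exact: vge_half.
have [->|y10] := eqVneq y1 0; first by rewrite mul0r mulr0 mul0r; exact: subring0.
have [->|z10] := eqVneq z1 0; first by rewrite !mulr0 mul0r; exact: subring0.
case: vy1 => [/eqP|vy1]; first by rewrite (negPf y10).
case: vz1 => [/eqP|vz1]; first by rewrite (negPf z10).
have vval : v (b * (y1 * z1) / x) = v b + (v y1 + v z1) - v x.
  by rewrite (val_div hv) ?mulf_neq0 // !(val_mul hv) ?mulf_neq0.
have [xy|cy] := gap0 Iy1 y10 Rx x0 vy1; last first.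
  by apply: hc; right; rewrite vval; lia.
have [xz|cz] := gap0 Iz1 z10 Rx x0 vz1; last first.
  by apply: hc; right; rewrite vval; lia.
rewrite -mulrA; apply: subringM => //.
by apply: hA => //; [exact: IR | exact: IR | right | right].
Qed.

(** Three of the four terms are quotients by [x] settled by the Arf condition on [R]. For
    [y0 z0 / (b x)], below the bound [c], [gap1] raises the values of [y0] and [z0] to that of
    [b x], where the condition applies again. *)
Lemma arf_at_root x : I x -> x != 0 -> arf_at w S (io x * th).
Proof.
move=> Ix x0 _ _ [y0 [y1 [Ry0 Iy1 ->]]] [z0 [z1 [Rz0 Iz1 ->]]].
have Rx := IR Ix.
rewrite w_io_th // => /hw[vy0 vy1] /hw[vz0 vz1].
have vge_half0 r : vge2 (v x + v x + v b) 0 r -> vge v (v x) r.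
  by move=> [->|h]; [left | right; lia].
have vge_half1 r : vge2 (v x + v x + v b) (v b) r -> vge v (v x) r.
  by move=> [->|h]; [left | right; lia].
have -> : quad y0 y1 * quad z0 z1 / (io x * th) =
    quad (y0 * z1 / x + z0 * y1 / x) (y0 * z0 / (b * x) + y1 * z1 / x).
  have th_neq0 := th0.
  rewrite quadM /quad !rmorphD !rmorphM !fmorphV !rmorphM /= -hth; field.
  by rewrite fmorph_eq0 x0.
apply/quad_orderE; split.
  by apply: subringD => //; apply: hA => //;
    solve [exact: IR | exact: vge_half0 | exact: vge_half1].
apply: ID; last first.
  apply: (ideal_absorb Ix x0).
    have := vge_div hv x0 (vgeM hv (vge_half1 _ vy1) (vge_half1 _ vz1)).
    by rewrite addrK.
  by right; apply: hA => //; solve [exact: IR | exact: vge_half1].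
have [->|y00] := eqVneq y0 0; first by rewrite !mul0r.
have [->|z00] := eqVneq z0 0; first by rewrite mulr0 mul0r.
case: vy0 => [/eqP|vy0]; first by rewrite (negPf y00).
case: vz0 => [/eqP|vz0]; first by rewrite (negPf z00).
apply: (ideal_absorb Ix x0).
  by right; rewrite (val_div hv) ?mulf_neq0 // !(val_mul hv) //; lia.
rewrite addr0 in vy0; rewrite addr0 in vz0.
have [xy|cx] := gap1 Ix x0 Ry0 y00 vy0; last by left.
have [xz|cx] := gap1 Ix x0 Rz0 z00 vz0; last by left.
right; apply: hA => //; first exact: subringM.
- by rewrite mulf_neq0.
- by right; rewrite (val_mul hv) // addrC.
- by right; rewrite (val_mul hv) // addrC.
Qed.

(** The value of [x + y th] equals that of [x] or of [y th], and [arf_at_eq] carries the condition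
    over from that coordinate. *)
Lemma arf_quad_order : W = int_closure S -> arf_set w S.
Proof.
move=> hW _ [x [y [Rx Iy ->]]] q0.
have SW : S `<=` W by rewrite hW; apply: sub_int_closure; exact: quad_order_subring.
have Sxy : S (quad x y) by apply/quad_orderE.
have [le_xy lt_yx] : vge2 (w (quad x y)) 0 x /\ vge2 (w (quad x y)) (v b) y
  by apply/hw; exact: vge_self.
have wle m : vge2 m 0 x -> vge2 m (v b) y -> m <= w (quad x y).
  by move=> h1 h2; apply: (vgeN0 q0); apply/hw.
have [xx|] := boolP ((x != 0) && ((y == 0) || (v x + v x <= v y + v y + v b))).
  have [x0 hxy] := andP xx.
  apply: (@arf_at_eq _ W w S _ (io x)) => //; last exact: arf_at_base.
  - exact: quad_order_subring.
  - by rewrite quad_io; apply/quad_orderE.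
  - by rewrite fmorph_eq0.
  rewrite w_io //; apply/eqP; rewrite eq_le; apply/andP; split.
    by case: le_xy => [/eqP|]; [rewrite (negPf x0) | rewrite addr0].
  apply: wle; first by right; rewrite addr0.
  by case/orP: hxy => [/eqP ->|]; [left | right].
move=> hxy; have y0 : y != 0.
  apply: contraNneq hxy => y0; rewrite y0 eqxx /= andbT.
  by apply: contra_neq q0 => ->; rewrite y0 quad0.
apply: (@arf_at_eq _ W w S _ (io y * th)) => //; last exact: arf_at_root.
- exact: quad_order_subring.
- by rewrite quad_th; apply/quad_orderE; split=> //; exact: (subring0 hR).
- by rewrite mulf_neq0 ?th0 // fmorph_eq0.
rewrite w_io_th //; apply/eqP; rewrite eq_le; apply/andP; split.
  by case: lt_yx => [/eqP|//]; rewrite (negPf y0).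
apply: wle; last by right.
have [->|x0] := eqVneq x 0; first by left.
by right; move: hxy; rewrite x0 (negPf y0) /=; lia.
Qed.

End Backward.
End QuadraticArf.
End Quadratic.

(** * Embeddings of fraction fields and reduction modulo [t ^ 2 - b] *)

Lemma subf_div (F : fieldType) (x y z t : F) : y != 0 -> t != 0 ->
  x / y - z / t = (x * t - z * y) / (y * t).
Proof. by move=> y0 t0; rewrite -mulNr addf_div // mulNr. Qed.

Lemma frac_lift (A : idomainType) (L : fieldType) (j : {rmorphism A -> L}) :
  injective j -> exists io : {rmorphism {fraction A} -> L},
  forall a, io (tofrac a) = j a.
Proof.
move=> jinj.
have j0 a : (j a == 0) = (a == 0) by rewrite -(rmorph0 j) (inj_eq jinj).
have [num hnum] := choice (@frac_rep A); have [den hden] := choice hnum.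
pose io (z : {fraction A}) : L := j (num z) / j (den z).
have ioE z a d : d != 0 -> z = tofrac a / tofrac d -> io z = j a / j d.
  move=> d0 ez; have [dz0 e] := hden z; rewrite /io.
  have h : num z * d = a * den z.
    apply/eqP; rewrite -tofrac_eq !tofracM; apply/eqP.
    have fd : tofrac d != 0 by rewrite tofrac_eq0.
    have fdz : tofrac (den z) != 0 by rewrite tofrac_eq0.
    by apply/eqP; rewrite -eqr_div // -e -ez.
  apply/eqP; rewrite eqr_div ?j0 //; apply/eqP.
  by rewrite -!rmorphM h.
have ioD : zmod_morphism io.
  move=> x y; have [dx ex] := hden x; have [dy ey] := hden y.
  rewrite [io x]/io [io y]/io.
  rewrite (ioE _ (num x * den y - num y * den x) (den x * den y)) ?mulf_neq0 //.
    by rewrite subf_div ?j0 // rmorphB !rmorphM.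
  by rewrite {1}ex {1}ey subf_div ?tofrac_eq0 // tofracB !tofracM.
have ioM : monoid_morphism io.
  split.
    by rewrite (ioE _ 1 1) ?oner_neq0 // ?tofrac1 ?rmorph1 ?divr1.
  move=> x y; have [dx ex] := hden x; have [dy ey] := hden y.
  rewrite [io x]/io [io y]/io (ioE _ (num x * num y) (den x * den y)) ?mulf_neq0 //.
    by rewrite !rmorphM /= mulf_div.
  by rewrite {1}ex {1}ey !tofracM mulf_div.
pose IO : {rmorphism {fraction A} -> L} :=
  HB.pack io (GRing.isZmodMorphism.Build _ _ io ioD)
    (GRing.isMonoidMorphism.Build _ _ io ioM).
exists IO => a; rewrite /= (ioE _ a 1) ?oner_neq0 //.
  by rewrite rmorph1 divr1.
by rewrite tofrac1 divr1.
Qed.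

Section ReesQuotient.
Variables (R : idomainType) (I : set R).
Hypothesis hI : is_ideal I.

Lemma idealX_sub k x : idealX I k.+1 x -> I x.
Proof.
have [I0 ID IM] := hI; case=> s hs ->; rewrite big_seq.
by apply: big_ind => // p /hs[p1 _]; rewrite mulrC; apply: IM.
Qed.

Lemma rees_linear_mem c d : I d -> c%:P + d *: 'X \in rees_pred I.
Proof.
have [I0 _ _] := hI; move=> Id; apply/asboolP => i.
have [h0 _ _] := idealX_ideal I i.
rewrite coefD coefC coefZ coefX; case: i h0 => [//|[|i]] h0 /=.
  rewrite add0r mulr1; exists [:: (d, 1)]; last by rewrite big_seq1 mulr1.
  by move=> p; rewrite inE => /eqP ->.
by rewrite add0r mulr0.
Qed.

Variable b : R.

(** The linear coefficient of the remainder is a combination of odd coefficients of [p] by powers of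
    [b]. The hypothesis on odd coefficients survives dropping the two lowest ones, as the induction
    requires. *)
Lemma quad_reduction (p : {poly R}) : (forall i, odd i -> I p`_i) ->
  exists q c d, I d /\ p = q * ('X^2 - b%:P) + (c%:P + d *: 'X).
Proof.
have [I0 ID IM] := hI.
have [n] := ubnP (size p); elim: n p => // n IH p sp hp.
have [p0|p0] := eqVneq p 0.
  by exists 0, 0, 0; split=> //; rewrite p0 mul0r scale0r !addr0.
have [||q [c [d [Id e]]]] := IH (drop_poly 2 p).
- have := size_poly_gt0 p; rewrite p0 size_drop_poly; lia.
- by move=> i oi; rewrite coef_drop_poly; apply: hp; rewrite oddD addbF.
exists (drop_poly 2 p + b *: q), (p`_0 + b * c), (p`_1 + b * d); split.
  by apply: ID; [exact: hp | exact: IM].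
have ep : p = (p`_0)%:P + p`_1 *: 'X + drop_poly 2 p * 'X^2.
  rewrite -[LHS](poly_take_drop 2); congr (_ + _); apply/polyP => i.
  by rewrite coef_take_poly coefD coefC coefZ coefX; case: i => [|[|i]] //=;
    rewrite ?mulr0 ?mulr1 ?addr0 ?add0r.
rewrite {1}ep -!mul_polyC !(polyCD, polyCM) !mulrDl.
have := congr1 (fun u => b%:P * u) e; rewrite /= => eb.
transitivity ((p`_0)%:P + (p`_1)%:P * 'X + drop_poly 2 p * ('X^2 - b%:P) + b%:P * drop_poly 2 p).
  by ring.
by rewrite eb -!mul_polyC; ring.
Qed.

Variable hb : frac_nonsquare b.
Local Notation Q := (rees_quot I hb).

Definition rees_class (p : rees I) : Q := (\pi_({ideal_quot (@quad_ideal R I b)}) p)%qT.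

Lemma rees_classD p q : rees_class (p + q) = rees_class p + rees_class q.
Proof. exact: (rmorphD (\pi_({ideal_quot (@quad_ideal R I b)}))%qT). Qed.

Lemma rees_classM p q : rees_class (p * q) = rees_class p * rees_class q.
Proof. exact: (rmorphM (\pi_({ideal_quot (@quad_ideal R I b)}))%qT). Qed.

Lemma rees_class1 : rees_class 1 = 1.
Proof. exact: (rmorph1 (\pi_({ideal_quot (@quad_ideal R I b)}))%qT). Qed.

Lemma rees_class_eq (p q : rees I) : rees_class p = rees_class q <->
  exists u, rees_poly p - rees_poly q = u * ('X^2 - b%:P).
Proof.
have -> : (rees_class p = rees_class q) <-> (p - q \in @quad_ideal R I b).
  by rewrite Quotient.idealrBE; split=> /eqP.
by split=> /asboolP.
Qed.

Lemma rees_class_surj (x : Q) : exists p, x = rees_class p.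
Proof. by exists (repr (x : {ideal_quot (@quad_ideal R I b)})); rewrite /rees_class reprK. Qed.

End ReesQuotient.

(** * The multiplicity sequence against the value of [b] *)

Section Multiplicities.
Variables (K L : fieldType) (io : {rmorphism K -> L}) (th : L) (b : K) (R I : set K).
Local Notation v := (valuation R).
Local Notation e := (mult_seq R).
Local Notation s := (mult_sum R).
Local Notation S := (quad_order io th R I).
Hypotheses (hR : subring_set R) (hv : normalized_valuation (int_closure R) v).
Variable c0 : int.
Hypothesis hc0 : forall z, vge v c0 z -> R z.
Hypothesis hres : forall z, vge v 0 z -> exists2 a, R a & vge v 1 (z - a).
Hypotheses (hth : th ^+ 2 = io b) (Rb : R b) (b0 : b != 0) (vb_odd : odd `|v b|%N).
Lemma odd_value_ge1 : 1 <= v b.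
Proof. by have := vgeN0 b0 (subring_vge hR hv Rb); lia. Qed.

Variables (W : set L) (w : L -> int).
Hypotheses (hwW : normalized_valuation W w) (hW : W = int_closure S).
Hypothesis hw : forall m x y,
  vge w m (quad io th x y) <-> vge2 v m 0 x /\ vge2 v m (v b) y.
Hypotheses (IR : I `<=` R) (I0 : I 0) (ID : forall x y, I x -> I y -> I (x + y))
  (IM : forall a x, R a -> I x -> I (a * x)).
Hypotheses (hA : arf_set v R) (hI : value_ideal v R I).
Variable n : nat.
Hypothesis hn1 : forall k, (n <= k)%N -> e k = 1.

Let hc z : vge v (s n) z -> R z.
Proof. exact: (mult_sum_conductor hR hv hA hc0 hn1 hres). Qed.

(** An [i] in [I] below the conductor has value [s k] with [k < n], and the next value of [R] is
    [s k + e k = v i + v b]; this provides both gap conditions. *)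
Lemma mult_seq_arf_quad :
  ((exists i, [/\ I i, i != 0 & v i < s n]) -> forall k, (k < n)%N -> v b = e k) ->
  arf_set w S.
Proof.
move=> heq; have vb := odd_value_ge1.
have jump i r : I i -> i != 0 -> R r -> r != 0 -> v i < v r ->
    v i + v b <= v r \/ s n <= v i.
  move=> Ii i0 Rr r0 lt_ir; have [ni|lt_i] := leP (s n) (v i); first by right.
  left; have [k ek] := value_mult_sum hR hv hA hc0 (IR Ii) i0.
  have kn : (k < n)%N.
    rewrite ltnNge; apply/negP => nk.
    by have := mult_sum_le hR hv hA hc0 nk; rewrite -ek; lia.
  rewrite (heq _ k kn) ?ek -?mult_sumS; last by exists i.
  by apply: (mult_sum_next hR hv hA hc0) => //; rewrite -ek.
apply: (arf_quad_order hth hv b0 vb_odd hw hwW hR Rb IR I0 ID IM hA hI vb hc) => //.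
- move=> i r Ii i0 Rr r0 h; have [|lt_ir] := leP (v r) (v i); first by left.
  by have [] := jump i r Ii i0 Rr r0 lt_ir; [lia | right].
- move=> i r Ii i0 Rr r0 h; apply: jump => //; lia.
Qed.

Hypothesis hn : (0 < n)%N -> e n.-1 <> 1.

Lemma arf_quad_mult_seq i : arf_set w S -> I i -> i != 0 -> v i < s n ->
  forall k, (k < n)%N -> v b = e k.
Proof.
move=> hS Ii i0 lt_i; have vb := odd_value_ge1.
have vi := vgeN0 i0 (subring_vge hR hv (IR Ii)).
case: n hn1 hn lt_i hc => [|m] hm1 hm lt_i hcm.
  by move: lt_i; rewrite /mult_sum big_ord0; lia.
have [d [Rd d0 vd _]] := mult_chain hR hv hA hc0 m.
have em := mult_seq_ge1 hR hv hA hc0 m.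
have {}hm : e m <> 1 by apply: hm.
have sm := mult_sumS R m.
(* [v i] is a sum smaller than [s m.+1], hence at most [s m = v d]. *)
have Id : I d.
  apply: (hI Ii i0 Rd); right; rewrite vd.
  have [k ek] := value_mult_sum hR hv hA hc0 (IR Ii) i0.
  rewrite ek; apply: (mult_sum_le hR hv hA hc0); rewrite -ltnS ltnNge; apply/negP => mk.
  by have := mult_sum_le hR hv hA hc0 mk; rewrite -ek; lia.
(* A value of [y ^ 2 / (d b)] above [s m] must reach [s m.+1]. *)
have sqr y : y != 0 -> s m.+1 <= v y -> s m + s m + v b <= v y + v y ->
    s m < v y + v y - s m - v b -> e m <= v y + v y - s m - s m - v b.
  move=> y0 ny hy lt_y; have Ry : R y by apply: hcm; right.
  have Iy : I (y * y / (d * b)).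
    apply: (quad_arf_sqr hth hv b0 vb_odd hw hR I0 hS) => //.
    by right; rewrite vd addr0.
  have q0 : y * y / (d * b) != 0 by rewrite !mulf_neq0 ?invr_neq0 ?mulf_neq0.
  have vq : v (y * y / (d * b)) = v y + v y - s m - v b.
    by rewrite (val_div hv) ?mulf_neq0 // !(val_mul hv) // vd; lia.
  have := mult_sum_next hR hv hA hc0 (k := m) (IR Iy) q0.
  by rewrite vq sm => /(_ lt_y); lia.
have le_b : v b <= e m.
  (* [h] is half of [v b + 1]. If [e m <= h], taking [v y = s m + h] gives the value [s m + 1],
     which forces [e m = 1]. Otherwise [v y = s m.+1] gives [e m <= 2 e m - v b]. *)
  have [h hh] : exists h : int, v b + 1 = h + h by exists ((v b + 1) %/ 2)%Z; move: vb_odd; lia.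
  have [le_h|lt_h] := leP (e m) h.
    have [y y0 vy] := val_exists hv (s m + h).
    by have := sqr y y0; rewrite vy; lia.
  have [y y0 vy] := val_exists hv (s m.+1).
  by have := sqr y y0; rewrite vy sm; lia.
(* [b] is an element of [R] of positive value. With monotonicity,
   [e 0 <= v b <= e m <= e k <= e 0]. *)
have ge_b : e 0%N <= v b.
  have := mult_sum_next hR hv hA hc0 (k := 0) Rb b0.
  by rewrite mult_sumS /mult_sum big_ord0; lia.
move=> k hk.
have := mult_seq_noninc hR hv hA hc0 (leq0n k).
have := @mult_seq_noninc _ _ hR hv hA _ hc0 k m hk.
by lia.
Qed.

End Multiplicities.

(** * The quotient of the Rees algebra as the order [R + I th] *)

Section ReesFraction.
Variables (R : idomainType) (I : set R) (b : R).
Hypotheses (hI : is_ideal I) (hb : frac_nonsquare b).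
Local Notation Q := (rees_quot I hb).
Local Notation K := {fraction R}.
Local Notation L := {fraction Q}.

Definition rees_linear c d (Id : I d) : rees I := Rees (rees_linear_mem hI c Id).

(** The class of [t] need not exist in the quotient, so [th] is the class of [i t] divided by that
    of [i]. Reduction modulo [t ^ 2 - b] then writes every class as [c + d th] with [d] in [I]. *)
Lemma rees_frac_structure i : I i -> i != 0 ->
  exists (io : {rmorphism K -> L}) (th : L),
  [/\ th ^+ 2 = io (tofrac b),
      frac_range Q = quad_order io th (frac_range R) (@tofrac R @` I) &
      forall l : L, exists p q, [/\ frac_range Q p, frac_range Q q, q != 0 & l = p / q]].
Proof.
move=> Ii i0; have [I0 ID IM] := hI.
pose cl c d (Id : I d) := rees_class hb (rees_linear c Id).
have classE p q : rees_poly p = rees_poly q -> rees_class hb p = rees_class hb q.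
  by move=> h; apply/rees_class_eq; exists 0; rewrite h subrr mul0r.
pose j a : L := tofrac (cl a 0 I0).
have jD : zmod_morphism j.
  move=> x y; apply/eqP; rewrite eq_sym subr_eq -tofracD -rees_classD; apply/eqP.
  congr tofrac; apply: classE => /=.
  by rewrite scale0r !addr0 polyCB subrK.
have jM : monoid_morphism j.
  split; first by rewrite /j -(tofrac1 Q) -(rees_class1 I hb); congr tofrac;
    apply: classE; rewrite /= scale0r addr0.
  move=> x y; rewrite /j -tofracM -rees_classM; congr tofrac; apply: classE => /=.
  by rewrite scale0r !addr0 polyCM.
pose J : {rmorphism R -> L} := HB.pack j (GRing.isZmodMorphism.Build _ _ j jD)
    (GRing.isMonoidMorphism.Build _ _ j jM).
have Jinj : injective J.
  move=> x y /eqP; rewrite tofrac_eq => /eqP /rees_class_eq[u] /=.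
  rewrite scale0r !addr0 -polyCB => hu.
  have [u0|u0] := eqVneq u 0.
    by move: hu; rewrite u0 mul0r => /eqP; rewrite polyC_eq0 subr_eq0 => /eqP.
  have := congr1 (fun p : {poly R} => size p) hu.
  rewrite /= size_Mmonic ?monicXnsubC // size_XnsubC // addn3 /= => e.
  by have := size_polyC_leq1 (x - y); rewrite e.
have [io ioE] := frac_lift Jinj.
have ji0 : j i != 0 by rewrite -[j]/(J : R -> L) -(rmorph0 J) (inj_eq Jinj).
pose t : L := tofrac (cl 0 i Ii).
have clE c d (Id : I d) : tofrac (cl c d Id) = io (tofrac c) + io (tofrac d) * (t / j i).
  rewrite !ioE /=; apply: (mulIf ji0); rewrite mulrDl mulrA divfK //.
  rewrite /j /t /cl -!tofracM -!rees_classM -tofracD -rees_classD.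
  congr tofrac; apply: classE => /=.
  by rewrite -!mul_polyC ?polyC0; ring.
exists io, (t / j i); split.
- rewrite expr_div_n; apply: (canLR (mulfK _)); first by rewrite expf_neq0.
  have -> : io (tofrac b) * j i ^+ 2 = j (b * i ^+ 2).
    by rewrite ioE -[j i]/(J i) -[j (_ * _)]/(J _) rmorphM rmorphXn.
  rewrite /j /t /cl -tofracXn expr2 -rees_classM; congr tofrac; apply/rees_class_eq => /=.
  (* The difference is [(i t) ^ 2 - b i ^ 2 = i ^ 2 (t ^ 2 - b)]. *)
  exists (i ^+ 2)%:P.
  by rewrite -!mul_polyC ?polyC0 !(polyCM, rmorphXn) /=; ring.
- apply/seteqP; split=> [_ [x _ <-]|l [x [y [[c _ <-] [d Id <-] ->]]]]; last first.
    by exists (cl c d Id) => //; exact: clE.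
  have [p ->] := rees_class_surj x.
  have hp k : odd k -> I (rees_poly p)`_k.
    case: k => // k _; apply: (idealX_sub hI (k := k)).
    by case: p => p pI /=; move/asboolP: pI => pI; exact: (pI k.+1).
  have [q [c [d [Id e]]]] := quad_reduction hI b hp.
  exists (tofrac c), (tofrac d); split; [by exists c | by exists d|].
  rewrite /quad -(clE c d Id); congr tofrac; apply/rees_class_eq => /=.
  by exists q; rewrite e addrK.
- move=> l; have [x [y [y0 ->]]] := frac_rep l.
  by exists (tofrac x), (tofrac y); split; rewrite ?tofrac_eq0 //; [exists x | exists y].
Qed.

End ReesFraction.

(** * Conductor bound and residues from the hypotheses on [R] *)

Section Irreducible.
Variable R : idomainType.
Hypotheses (hirr : analytically_irreducible R) (hres : residually_rational R).
Local Notation K := {fraction R}.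
Local Notation B := (frac_range R).
Local Notation v := (valuation B).

Lemma irreducible_valuation : normalized_valuation (int_closure B) v.
Proof. by have [[w hw] _] := hirr; exact: valuationP hw. Qed.
Let hv := irreducible_valuation.

(** A common denominator [d] of finitely many generators multiplies the whole integral closure into
    [R], so [v d] is a bound. *)
Lemma irreducible_conductor : exists c, forall z, vge v c z -> B z.
Proof.
have hB := frac_range_subring R.
have [_ [s es]] := hirr.
have [d d0 hd] : exists2 d : R, d != 0 & forall i, (i < size s)%N -> B (tofrac d * s`_i).
  elim: s {es} => [|x s [d d0 hd]]; first by exists 1; rewrite ?oner_neq0.
  have [a [c [c0 ->]]] := frac_rep x.
  exists (c * d); first by rewrite mulf_neq0.
  case=> [_|i] /=; rewrite tofracM.
    by exists (d * a) => //; rewrite tofracM [RHS]mulrCA mulrAC -mulrA mulVKf ?tofrac_eq0 // mulrC.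
  rewrite ltnS -mulrA => hi; apply: (subringM hB); last exact: hd.
  by exists c.
have fd0 : tofrac d != 0 by rewrite tofrac_eq0.
exists (v (tofrac d)) => z vz.
have : int_closure B (z / tofrac d).
  by apply/(val_ring hv); have := vge_div hv fd0 vz; rewrite subrr.
rewrite es => -[c hc ez]; have -> : z = tofrac d * (z / tofrac d) by rewrite mulrCA divff // mulr1.
rewrite ez mulr_sumr; apply: (subring_sum hB) => i _.
by rewrite mulrCA; apply: (subringM hB); [exact: hc | exact: hd].
Qed.

Lemma irreducible_residue z : vge v 0 z -> exists2 a, B a & vge v 1 (z - a).
Proof.
move=> /(val_ring hv) Vz; have [_ /(_ z Vz)[a Ba [/(val_ring hv) Va na]]] := hres.
exists a => //; case: Va => [->|va]; [by left|].
have [->|za0] := eqVneq (z - a) 0; first by left.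
right; move: va; rewrite le_eqVlt => /orP[/eqP va|]; last by lia.
case: na; exists (z - a)^-1; last by rewrite divff.
by apply/(val_ring hv); right; rewrite (val_inv hv) // -va.
Qed.

End Irreducible.

(** * The integral closure of [R + I th] *)

Section IntegralClosure.
Variables (A Q : idomainType) (io : {rmorphism {fraction A} -> {fraction Q}}).
Variables (th : {fraction Q}) (b : {fraction A}) (I : set {fraction A}).
Local Notation B := (frac_range A).
Hypothesis hS : frac_range Q = quad_order io th B I.
Hypotheses (hth : th ^+ 2 = io b) (Bb : B b) (IB : I `<=` B) (I0 : I 0).
Variable v : {fraction A} -> int.
Hypothesis hv : normalized_valuation (int_closure B) v.
Hypotheses (b0 : b != 0) (vb_odd : odd `|v b|%N).
Variables (W : set {fraction Q}) (w : {fraction Q} -> int).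
Hypothesis hwW : normalized_valuation W w.
Hypothesis hgen : forall l, exists x y, l = io x + io y * th.
Hypothesis hw : forall m x y,
  vge w m (quad io th x y) <-> vge2 v m 0 x /\ vge2 v m (v b) y.

(** If [w (x + y th) >= 0], then the trace [x + x] and the norm have nonnegative values, so
    [x + y th] is a root of a monic quadratic with integral coefficients. *)
Lemma quad_int_closure : W = int_closure (frac_range Q).
Proof.
have Bv a : B a -> vge v 0 a.
  by move=> /(sub_int_closure (frac_range_subring A)) /(val_ring hv).
have vb := vgeN0 b0 (Bv _ Bb).
apply/seteqP; split; last first.
  apply: (int_closure_sub hwW) => z; rewrite hS => -[x [y [Bx Iy ->]]].
  apply/(val_ring hwW)/hw; split.
    by case: (Bv x Bx) => [->|h]; [left | right; lia].
  by case: (Bv y (IB Iy)) => [->|h]; [left | right; lia].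
have ioV a : vge v 0 a -> integralOver (@tofrac Q) (io a).
  move=> /(val_ring hv)[p [mp cp rp]]; apply/int_closure_integral.
  exists (map_poly io p); split; first exact: monic_map.
    move=> i; rewrite coef_map hS; exists p`_i, 0; split=> //.
    by rewrite /quad rmorph0 mul0r addr0.
  exact: rmorph_root.
move=> l /(val_ring hwW) vl; have [x [y el]] := hgen l.
move: vl; rewrite el => /hw[vx vy]; apply/int_closure_integral.
apply: (integralOver_quadratic (t := io (x + x)) (n := io (qnorm b x y))).
- by apply: ioV; case: vx => [->|h]; [left; rewrite addr0 | apply: (vgeD hv); right; lia].
- apply: ioV; have [xy|] := boolP ((x != 0) || (y != 0)).
    by right; apply/(qnorm_val hv b0 vb_odd 0 xy).2.
  by rewrite negb_or !negbK => /andP[/eqP -> /eqP ->]; left; rewrite /qnorm expr0n mulr0 subr0.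
- exact: (quad_root hth).
Qed.

End IntegralClosure.

(** * Transfer to the order [R + I th] and proof of both implications *)

Theorem theorem3p9 (R : idomainType)
    (hnoeth : noetherian R) (hdim : krull_dim R 1) (hloc : local_ring R)
    (hirr : analytically_irreducible R) (hres : residually_rational R)
    (hchar : 2%N \notin [pchar R])
    (I : set R) (hI : is_ideal I) (hI0 : I != [set 0])
    (b : R) (hb : odd_val b) :
  Arf (rees_quot I (odd_val_nonsquare hirr hb)) <->
  exists (n : nat) (e : nat -> int),
    [/\ [/\ Arf R, forall i, e i = mult_seq (frac_range R) i,
            forall k, (n <= k)%N -> e k = 1 & (0 < n)%N -> e n.-1 <> 1],
        integrally_closed I &
        conductor R `<` @tofrac R @` I ->
          forall i, (i < n)%N -> value b = e i].
Proof.
set hns := odd_val_nonsquare hirr hb; case: (hb) => b0 vb_odd.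
have hv := irreducible_valuation hirr.
have hB := frac_range_subring R.
have [c0 hc0] := irreducible_conductor hirr.
have hr := irreducible_residue hirr hres.
have [i [Ii i0 _]] := ideal_min hv hI hI0.
have [io [th [hth hS hrep]]] := rees_frac_structure hI hns Ii i0.
set IK := @tofrac R @` I in hS *.
have [I0 ID IM] := hI.
have IR : IK `<=` frac_range R by move=> _ [x _ <-]; exists x.
have IK0 : IK 0 by exists 0 => //; exact: tofrac0.
have IKD x y : IK x -> IK y -> IK (x + y).
  by move=> [x' Ix <-] [y' Iy <-]; exists (x' + y'); [exact: ID | exact: tofracD].
have IKM a x : frac_range R a -> IK x -> IK (a * x).
  by move=> [a' _ <-] [x' Ix <-]; exists (a' * x'); [exact: IM | exact: tofracM].
have fb0 : tofrac b != 0 by rewrite tofrac_eq0.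
have Rb : frac_range R (tofrac b) by exists b.
(* Elements of [L] are quotients of elements of the order, and the conjugate clears the
   denominator. *)
have hgen l : exists x y, l = io x + io y * th.
  have [p [q []]] := hrep l; rewrite hS => -[x [y [_ _ ->]]] [x' [y' [_ _ ->]]] q0 ->.
  rewrite (quad_inv hth hv fb0 vb_odd q0) (quadM hth).
  by eexists; eexists.
have [w0 [hw0 hw0E]] := quad_valuation hth hgen hv fb0 vb_odd.
have hW := quad_int_closure hS hth Rb IR IK0 hv fb0 vb_odd hw0 hgen hw0E.
rewrite hW in hw0; have hw := valuationP hw0.
set w := valuation _ in hw.
(* [Arf] refers to the chosen [valuation] of the quotient, while [w0] comes from the norm;
   uniqueness transports the coordinatewise description. *)
have w0E := normalized_valuation_uniq hw hw0.
have hwE m x y : vge w m (quad io th x y) <->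
    vge2 (valuation (frac_range R)) m 0 x /\
    vge2 (valuation (frac_range R)) m (valuation (frac_range R) (tofrac b)) y.
  rewrite -hw0E; have [->|q0] := eqVneq (quad io th x y) 0; first by split; left.
  by rewrite /vge (w0E _ q0).
have arfQ : Arf (rees_quot I hns) <-> arf_set w (quad_order io th (frac_range R) IK).
  by rewrite -hS; exact: Arf_arf_set hw.
have vb : 1 <= valuation (frac_range R) (tofrac b).
  exact: odd_value_ge1 hB hv Rb fb0 vb_odd.
have icI : integrally_closed I <-> value_ideal (valuation (frac_range R)) (frac_range R) IK.
  rewrite (integrally_closedP hv hI hI0); split=> [hc|hc x a Ix x0 va].
    move=> _ _ [x Ix <-] x0 [a _ <-] va; exists a => //.
    by apply: (hc x) => //; rewrite -tofrac_eq0.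
  have [|||| a' Ia /eqP] := hc (tofrac x) (tofrac a) => //;
    [by exists x | by rewrite tofrac_eq0 | by exists a |].
  by rewrite tofrac_eq => /eqP <-.
rewrite hS in hw.
split.
  move=> /arfQ hA.
  have hAR := quad_arf_base hth hv fb0 vb_odd hwE IK0 hA.
  have hIv := quad_arf_ideal hth hv fb0 vb_odd hwE hB IR IK0 hA vb.
  have [n [hn1 hn]] := mult_seq_eventually1 hB hv hAR hc0.
  exists n, (mult_seq (frac_range R)); split.
  - by split=> //; apply/(Arf_arf_set hv).
  - exact/icI.
  move=> /(conductor_proper hB hv hAR hc0 hn1 hr hn IK0 hIv)[x [Ix x0 lt_x]].
  exact: (arf_quad_mult_seq hB hv hc0 hr hth Rb fb0 vb_odd hwE IR IK0 hAR hIv hn1 hn hA Ix x0 lt_x).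
move=> [n [e [[/(Arf_arf_set hv) hAR /funext -> hn1 hn] /icI hIv hb_eq]]].
apply/arfQ.
apply: (mult_seq_arf_quad hB hv hc0 hr hth Rb fb0 vb_odd hw _ hwE IR IK0 IKD IKM hAR hIv hn1) => //.
move=> /(conductor_proper hB hv hAR hc0 hn1 hr hn IK0 hIv); exact: hb_eq.
Qed.
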